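(* Let $\mathcal{A}$ be a compact metric space, $\Omega=\mathcal{A}^{\mathbb{N}}$ equipped with a metric $d_{\Omega}$ which induces the product topology, $0<\alpha<1$, and let $p$ be an a priori Borel probability measure on $\mathcal{A}$ having full support. If $f\in C^{\alpha}(\Omega)$ then, for $\mu\in\mathscr{M}_{\sigma}(\Omega)$, $\mathtt{h}(\mu|\mu_{\bar f})=0$ if and only if $\mu\in\mathcal{G}^{*}(\bar f)$. In particular, the set of the equilibrium states for $f$ is a singleton.
   Context: Setting. $(\mathcal{A},d_{\mathcal{A}})$ is an arbitrary compact metric space (possibly uncountable), $\mathbb{N}=\{1,2,\dots\}$, and $\Omega=\mathcal{A}^{\mathbb{N}}$ is equipped with the product topology, its Borel sigma-algebra, and a metric $d_{\Omega}$ which induces the product topology; for example, $d_{\Omega}(x,y)=\sum_{n\ge1}2^{-n}\frac{d_{\mathcal{A}}(x_n,y_n)}{1+d_{\mathcal{A}}(x_n,y_n)}$. $\sigma:\Omega\to\Omega$ is the left shift; $\mathscr{M}_1(\Omega)$ is the set of Borel probability measures on $\Omega$ and $\mathscr{M}_{\sigma}(\Omega)$ the subset of shift-invariant ones. $C(\Omega)$ is the space of real continuous functions on $\Omega$, and $C^{\alpha}(\Omega)$ is the space of $f:\Omega\to\mathbb{R}$ with $\sup_{x\ne y}|f(x)-f(y)|/d_{\Omega}(x,y)^{\alpha}<\infty$. Ruelle operator. $\mathscr{L}_f(\varphi)(x)=\int_{\mathcal{A}}e^{f(ax)}\varphi(ax)\,dp(a)$, where $ax=(a,x_1,x_2,\dots)$.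 $\mathscr{L}_f^{*}$ is the Banach transpose of $\mathscr{L}_f:C(\Omega)\to C(\Omega)$, acting on finite signed Borel measures. By a generalized Ruelle-Perron-Frobenius theorem (taken from the literature), to $f\in C^{\alpha}(\Omega)$ one associates the maximal eigenvalue $\lambda_f$ of $\mathscr{L}_f$ acting on $C^{\alpha}(\Omega)$ and a strictly positive eigenfunction $h_f\in C^{\alpha}(\Omega)$ for $\lambda_f$. The associated cohomologous normalized potential is $\bar f=f+\log h_f-\log(h_f\circ\sigma)-\log\lambda_f$; it satisfies $\mathscr{L}_{\bar f}(1)=1$. Put $\mathcal{G}^{*}(\bar f)=\{\nu\in\mathscr{M}_1(\Omega):\mathscr{L}_{\bar f}^{*}\nu=\nu\}$; this set is taken (from the same literature) to be a singleton contained in $\mathscr{M}_{\sigma}(\Omega)$, and $\mu_{\bar f}$ denotes its unique element. Entropies. For probability measures $\mu,\nu$ on $\Omega$ and finite $\Lambda\subset\mathbb{N}$, let $\mathscr{F}_{\Lambda}$ be the sigma-algebra generated by the coordinates in $\Lambda$ and $\mathscr{H}_{\Lambda}(\mu|\nu)=\int_{\Omega}\frac{d\mu|_{\mathscr{F}_\Lambda}}{d\nu|_{\mathscr{F}_\Lambda}}\log\frac{d\mu|_{\mathscr{F}_\Lambda}}{d\nu|_{\mathscr{F}_\Lambda}}\,d\nu$ if $\mu\ll\nu$ on $\mathscr{F}_{\Lambda}$, and $+\infty$ otherwise. With $\Lambda_n=\{1,\dots,n\}$, for $\mu\in\mathscr{M}_{\sigma}(\Omega)$ set $\mathtt{h}(\mu|\mu_{\bar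 f})=\lim_{n\to\infty}\frac1n\mathscr{H}_{\Lambda_n}(\mu|\mu_{\bar f})$ (a limit in the extended reals, whose existence is established beforehand). For a Borel probability measure $\mu$, $\mathtt{h}^{\mathtt{v}}(\mu)=\inf_{g\in C^{\alpha}(\Omega)}\{-\int_{\Omega}g\,d\mu+\log\lambda_g\}$, where $\lambda_g$ is the maximal eigenvalue of $\mathscr{L}_g$. Equilibrium states. An equilibrium state for $f$ is a $\mu\in\mathscr{M}_{\sigma}(\Omega)$ attaining the supremum $\sup_{\mu\in\mathscr{M}_{\sigma}(\Omega)}\{\mathtt{h}^{\mathtt{v}}(\mu)+\int_{\Omega}f\,d\mu\}$. *)

(* Defs.v *)
From HB Require Import structures.
From mathcomp Require Import all_boot all_order all_algebra.
From mathcomp Require Import all_classical all_reals all_analysis giry.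

Set Implicit Arguments.
Unset Strict Implicit.
Unset Printing Implicit Defensive.

Import Order.TTheory GRing.Theory Num.Theory.
Import numFieldNormedType.Exports.

Local Open Scope classical_set_scope.
Local Open Scope ring_scope.

(* [measurableType]s are pointed, so a base point is part of the structure; it
   is no restriction for a space that carries a probability measure. *)
#[short(type="pmetricType")]
HB.structure Definition PointedMetric (K : numDomainType) :=
  { T of Metric K T & isPointed T }.

Definition borel (T : ptopologicalType) := g_sigma_algebraType (@open T).

Definition full_support (R : realType) (T : ptopologicalType)
    (p : probability (borel T) R) : Prop :=
  forall U : set T, open U -> U !=set0 -> (0 < p U)%E.

(* The index set {1, 2, ...} is encoded by [nat], coordinate n being indexed by
   n - 1; [{ptws _ -> _}] carries the product topology. *)
Definition seqspace (T : topologicalType) := {ptws nat -> T}.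

HB.instance Definition _ (T : topologicalType) :=
  Topological.copy (seqspace T) {ptws nat -> T}.
HB.instance Definition _ (T : ptopologicalType) :=
  isPointed.Build (seqspace T) (fun=> point).

Section thermodynamic_formalism.
Variables (R : realType) (A : pmetricType R).
Local Notation Omega := (seqspace A).

Definition prepend (a : A) (x : Omega) : Omega :=
  fun n => if n is m.+1 then x m else a.

Definition shift (x : Omega) : Omega := fun n => x n.+1.

Record metrizes_product (d : Omega -> Omega -> R) : Prop := {
  metrizes_ge0 : forall x y, 0 <= d x y;
  metrizes_eq0 : forall x y, d x y = 0 <-> x = y;
  metrizes_sym : forall x y, d x y = d y x;
  metrizes_triangle : forall x y z, d x z <= d x y + d y z;
  metrizes_nbhs : forall (x : Omega) (U : set Omega),
    nbhs x U <-> exists2 e : R, 0 < e & [set y | d x y < e] `<=` U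
}.

Definition holder (d : Omega -> Omega -> R) (alpha : R) (f : Omega -> R) : Prop :=
  has_ubound [set `|f xy.1 - f xy.2| / d xy.1 xy.2 `^ alpha
             | xy in [set xy : Omega * Omega | xy.1 <> xy.2]].

Definition shift_invariant (mu : probability (borel Omega) R) : Prop :=
  forall B : set (borel Omega), measurable B -> mu (shift @^-1` B) = mu B.

Definition ruelle (p : probability (borel A) R) (f phi : Omega -> R) : Omega -> R :=
  fun x => \int[p]_a (expR (f (prepend a x)) * phi (prepend a x)).

Section eigendata.
Variables (d : Omega -> Omega -> R) (alpha : R) (p : probability (borel A) R).

Definition holder_eigenvalue (f : Omega -> R) : set R :=
  [set l | exists phi : Omega -> R,
    [/\ holder d alpha phi, exists x, phi x <> 0 &
        forall x, ruelle p f phi x = l * phi x]].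

Definition maximal_eigenvalue (f : Omega -> R) : set R :=
  [set l | holder_eigenvalue f l /\ ubound (holder_eigenvalue f) l].

(* There is at most one maximal eigenvalue; 0 is a dummy value for potentials
   that have none. *)
Definition lambda (f : Omega -> R) : R := xget 0 (maximal_eigenvalue f).

Record RPF_eigenfunction (f h : Omega -> R) : Prop := {
  RPF_maximal : maximal_eigenvalue f (lambda f);
  RPF_holder : holder d alpha h;
  RPF_gt0 : forall x, 0 < h x;
  RPF_eigen : forall x, ruelle p f h x = lambda f * h x
}.

Definition normalized (f h : Omega -> R) : Omega -> R :=
  fun x => f x + ln (h x) - ln (h (shift x)) - ln (lambda f).

(* A signed measure is identified with the functional it defines on C(Omega),
   so that the transpose sends nu to phi |-> \int (ruelle p g phi) dnu. *)
Definition Gstar (g : Omega -> R) : set (probability (borel Omega) R) :=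
  [set nu : probability (borel Omega) R | forall phi : Omega -> R, continuous phi ->
    \int[nu]_x ruelle p g phi x = \int[nu]_x phi x].

End eigendata.

Section specific_entropy.
Local Open Scope ereal_scope.

Definition coord_sets (L : set nat) : set (set Omega) :=
  \bigcup_(i in L) preimage_set_system [set: Omega] (fun x => x i : borel A)
                     (@measurable _ (borel A)).

Definition coord_space (L : set nat) := g_sigma_algebraType (coord_sets L).

Definition to_coord_space (L : set nat) (x : borel Omega) : coord_space L := x.

Lemma measurable_to_coord_space (L : set nat) :
  measurable_fun [set: borel Omega] (@to_coord_space L).
Proof.
apply: (@measurability _ _ (borel Omega) (coord_space L) _ _ (coord_sets L)) => //.
move=> _ [_ [i _ [B mB <-]] <-]; rewrite !setTI /to_coord_space /=.
suff : measurable_fun [set: borel Omega] (fun x : borel Omega => x i : borel A).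
  by move=> /(_ measurableT B mB); rewrite setTI.
apply: (@measurability _ _ (borel Omega) (borel A) _ _ (@open A)) => //.
move=> _ [U oU <-]; apply: sub_sigma_algebra; rewrite setTI.
apply: (@open_comp {ptws nat -> A} A (fun x => x i)) => // x _.
exact: (@proj_continuous nat (fun=> A) i).
Qed.

HB.instance Definition _ (L : set nat) :=
  isMeasurableFun.Build _ _ (borel Omega) (coord_space L) (@to_coord_space L)
    (@measurable_to_coord_space L).

(* The image under the identity map to a coarser sigma-algebra is the
   restriction of [mu] to that sigma-algebra. *)
Definition coord_restr (L : set nat) (mu : probability (borel Omega) R) :
  probability (coord_space L) R := distribution mu (@to_coord_space L).

Definition coord_density (L : set nat) (mu nu : probability (borel Omega) R) :
    Omega -> R := fun x =>
  fine (Radon_Nikodym (charge_of_finite_measure (coord_restr L mu))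
                      (coord_restr L nu) x).

Definition relative_entropy (L : set nat) (mu nu : probability (borel Omega) R) :
    \bar R :=
  if `[< coord_restr L mu `<< coord_restr L nu >] then
    \int[nu]_x (coord_density L mu nu x * ln (coord_density L mu nu x))%:E
  else +oo.

Definition specific_entropy (mu nu : probability (borel Omega) R) : \bar R :=
  limn (fun n : nat => (n%:R^-1)%:E * relative_entropy `I_n mu nu).

End specific_entropy.

Section equilibrium.
Variables (d : Omega -> Omega -> R) (alpha : R) (p : probability (borel A) R).
Local Open Scope ereal_scope.

Definition variational_entropy (mu : probability (borel Omega) R) : \bar R :=
  ereal_inf [set (- (\int[mu]_x g x)%R + ln (lambda d alpha p g))%R%:E
            | g in holder d alpha].

Definition equilibrium_state (f : Omega -> R) : set (probability (borel Omega) R) :=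
  [set mu : probability (borel Omega) R | shift_invariant mu /\
    variational_entropy mu + (\int[mu]_x f x)%R%:E =
    ereal_sup [set variational_entropy nu + (\int[nu]_x f x)%R%:E
              | nu in shift_invariant]].

End equilibrium.

End thermodynamic_formalism.

(* Elements of [probability T R] are functions on all subsets of T, so that
   equality of measures is tested on measurable sets only. *)
Definition is_the_measure d (T : measurableType d) (R : realType)
    (mu : probability T R) (M : set (probability T R)) : Prop :=
  forall nu, M nu <-> measure_eq nu mu.

(* Main.v *)
Require Import Defs.
From mathcomp Require Import all_boot all_order all_algebra.
From mathcomp Require Import all_classical all_reals all_analysis.
From mathcomp Require Import measurable_realfun ring lra.
Set Implicit Arguments.
Unset Strict Implicit.
Unset Printing Implicit Defensive.
Import Order.TTheory GRing.Theory Num.Theory.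
Import numFieldNormedType.Exports.
Local Open Scope classical_set_scope.
Local Open Scope ring_scope.

(* Let g be the normalized potential, L_g its operator and nu = mu_f.  For a
   continuous phi, the potential g + psi with psi = phi - log L_g(e^phi) o shift
   is again normalized, and for invariant mu the integral of psi is that of
   phi - log L_g(e^phi).  If this is <= 0 for all phi, then replacing phi by
   t phi and letting t -> 0 gives int phi dmu = int L_g(phi) dmu, so mu is a
   fixed point of the transpose.  Both parts of the theorem reduce to this:
   - Entropy.  Since int e^(S_n psi) dnu = 1, the Donsker-Varadhan inequality
     gives H_n(mu|nu) >= n int psi dmu - o(n), so that zero specific entropy
     forces int psi dmu <= 0.  The limit exists by a Fekete argument, because nu
     is a product measure up to factors e^(o(n)).
   - Equilibrium states.  An equilibrium state is a tangent functional at f to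
     g |-> log lambda_g.  The operator of f + psi has the eigenfunction h_f with
     eigenvalue lambda_f, and log lambda is 1-Lipschitz for the sup norm, so
     approximating psi by Hoelder functions gives int psi dmu <= 0. *)

(** * Topology of the sequence space *)

(** Three obstacles shape the argument. First, [d] is an arbitrary metric of the product topology,
    so Hoelder continuity gives no rate at which a function varies on long cylinders: the variations
    merely tend to 0. Distortion over [n] steps is thus bounded by the exponential of a sum of [n]
    variations, which is [o(n)] by Cesaro, and not by a constant. For the same reason [shift] need
    not be Lipschitz, and composing with it may leave the Hoelder class. Secondly, [Gstar] tests
    continuous functions only, while the test functions for the entropy of finitely many coordinates
    are merely measurable. The operator and its duality with [nu] are therefore extended to
    nonnegative Borel functions first. Thirdly, relative entropies may be infinite and densities may
    fail to exist. Estimates are therefore phrased with bounded test functions and with real numbers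
    strictly below the entropy, which treats the singular case on the same footing. *)

Section cylinders.
Context {R : realType} {A : pmetricType R}.
Local Notation Omega := (seqspace A).
Implicit Types x y : Omega.

Lemma proj_seq_continuous i : continuous (fun x : Omega => x i).
Proof. exact: (@proj_continuous nat (fun=> A) i). Qed.

Lemma cvg_seqspaceP (F : set_system Omega) (x : Omega) : Filter F ->
  (forall i, (fun y : Omega => y i) @ F --> x i) -> F --> x.
Proof.
move=> FF Fx; apply/cvg_sup => i /=.
rewrite cvg_image; last first.
  (* Constant sequences show that evaluation at [i] is onto. *)
  by rewrite eqEsubset; split => a // _; exists (fun=> a).
move=> W /(Fx i) FW; exists ((fun y : Omega => y i) @^-1` W) => //.
by rewrite image_preimage // eqEsubset; split => a // _; exists (fun=> a).
Qed.

Lemma continuous_to_seqspace (T : topologicalType) (F : T -> Omega) :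
  (forall i, continuous (fun t => F t i)) -> continuous F.
Proof.
by move=> cF t; apply: cvg_seqspaceP => i; apply: (cF i t).
Qed.

(** The sets that contain a cylinder around [x] form a filter [G]. It converges to [x] in each
    coordinate, hence in the product, so every neighbourhood of [x] belongs to it. *)
Lemma nbhs_cylinder x (U : set Omega) : nbhs x U -> exists n (V : nat -> set A),
  (forall i, nbhs (x i) (V i)) /\ [set y | forall i, (i < n)%N -> V i (y i)] `<=` U.
Proof.
pose G : set_system Omega := [set W | exists n (V : nat -> set A),
  (forall i, nbhs (x i) (V i)) /\ [set y | forall i, (i < n)%N -> V i (y i)] `<=` W].
have GF : Filter G.
  apply: Build_Filter.
  - by exists 0%N, (fun=> setT); split => // i; exact: filterT.
  - move=> P Q [n [V [xV VP]]] [m [W [xW WQ]]].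
    exists (maxn n m), (fun i => V i `&` W i); split => [i|y yVW]; first exact: filterI.
    split; [apply: VP|apply: WQ] => i im; apply yVW; rewrite leq_max im ?orbT//.
  - by move=> P Q PQ [n [V [xV VP]]]; exists n, V; split => // y /VP /PQ.
suff : G --> x by move=> h /h.
apply: cvg_seqspaceP => i W xW; exists i.+1, (fun j => if j == i then W else setT).
split => [j|y /(_ i (ltnSn i))]; last by rewrite eqxx.
by case: eqP => [->|_] //; exact: filterT.
Qed.

Lemma cylinder_nbhs x n (V : nat -> set A) : (forall i, nbhs (x i) (V i)) ->
  nbhs x [set y : Omega | forall i, (i < n)%N -> V i (y i)].
Proof.
move=> xV; elim: n => [|n IH]; first by apply: (@filterS _ _ _ setT) => //;
  exact: filterT.
have : nbhs x ((fun y : Omega => y n) @^-1` V n) by exact: proj_seq_continuous.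
move=> /(filterI IH); apply: filterS => y [yV yn] i.
rewrite ltnS leq_eqVlt => /orP[/eqP->//|].
exact: yV.
Qed.

Lemma seqspace_compact : compact [set: A] -> compact [set: Omega].
Proof.
move=> cA; have := @tychonoff nat (fun=> A) (fun=> setT) (fun=> cA).
by congr (compact _); rewrite eqEsubset; split.
Qed.

Lemma prepend_continuous :
  continuous (fun z : A * Omega => prepend z.1 z.2).
Proof.
apply: continuous_to_seqspace => -[|i] z /=; first exact: cvg_fst.
apply: (@continuous_comp _ _ _ snd (fun y : Omega => y i)); first exact: cvg_snd.
exact: proj_seq_continuous.
Qed.

Lemma shift_continuous : continuous (@Defs.shift R A).
Proof. by apply: continuous_to_seqspace => i; exact: proj_seq_continuous. Qed.

Lemma iter_shift_continuous n : continuous (iter n (@Defs.shift R A)).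
Proof.
elim: n => [|n IH] x; first exact: cvg_id.
apply: (@continuous_comp _ _ _ (iter n (@Defs.shift R A)) (@Defs.shift R A)).
  exact: IH.
exact: shift_continuous.
Qed.

Lemma iter_shiftE n x i : iter n (@Defs.shift R A) x i = x (n + i)%N.
Proof. by elim: n i => // n IH i; rewrite iterS /Defs.shift IH addSnnS. Qed.

(** Composing with it turns a continuous function into a nearby one that is measurable for the first
    [n] coordinates. *)
Definition truncate (n : nat) x : Omega := fun i => if (i < n)%N then x i else point.

Definition agree (n : nat) x y := forall i, (i < n)%N -> x i = y i.

(** Near [x], [u] varies little on some cylinder; a point that agrees long enough with a point of
    this cylinder lies in it too. Compactness makes the length uniform. *)
Lemma agree_uniform (u : Omega -> R) : compact [set: A] -> continuous u ->
  forall e, 0 < e -> \forall n \near \oo, forall x y, agree n x y -> `|u x - u y| < e.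
Proof.
move=> cA cu e e0.
suff H : forall x, [set: Omega] x -> \forall x' \near x & i \near \oo,
    forall y, agree i x' y -> `|u x' - u y| < e.
  have /compact_near_coveringP/(_ _ _ _ _ H) := seqspace_compact cA.
  by apply: filterS => n h x; exact: h.
move=> x _.
have /nbhs_cylinder[n [V [xV VU]]] : nbhs x [set y | `|u x - u y| < e / 2].
  by move/cvgrPdist_lt: (cu x); apply; rewrite divr_gt0.
exists ([set y | forall i, (i < n)%N -> V i (y i)], [set m | (n <= m)%N]); last first.
  move=> [z m] /= [Vz nm] y zy.
  have /VU/= uz : [set y | forall i, (i < n)%N -> V i (y i)] z by [].
  have /VU/= uy : [set y | forall i, (i < n)%N -> V i (y i)] y.
    by move=> i im; rewrite -zy ?(leq_trans im)//; exact: Vz.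
  rewrite (splitr e); apply: le_lt_trans (ltrD uz uy).
  by rewrite (distrC (u x) (u z)); have := ler_distD (u x) (u z) (u y).
split => /=; last by exists n.
exact: cylinder_nbhs.
Qed.

End cylinders.

(** * Measurability *)

Section borel_measurability.
Context {R : realType}.

Lemma continuous_borel (T S : ptopologicalType) (F : T -> S) :
  continuous F -> measurable_fun [set: borel T] (F : borel T -> borel S).
Proof.
move=> /continuousP cF.
apply: (@measurability _ _ (borel T) (borel S) _ _ (@open S)) => //.
by move=> _ [U oU <-]; apply: sub_sigma_algebra; rewrite setTI; exact: cF.
Qed.

Lemma continuous_borelR (T : ptopologicalType) (u : T -> R) :
  continuous u -> measurable_fun [set: borel T] (u : borel T -> R).
Proof.
move=> /continuousP cu; apply: (measurability _ (measurable_realfun.RGenOpens.measurableE R)).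
move=> _ [_ [a [b ->] <-]]; apply: sub_sigma_algebra; rewrite setTI.
exact/cu/interval_open.
Qed.

Lemma compact_bounded_fun (T : ptopologicalType) (u : T -> R) :
  compact [set: T] -> continuous u -> exists2 M, 0 <= M & forall x, `|u x| <= M.
Proof.
move=> cT cu.
have cu' : {within [set: T], continuous (fun x => `|u x|)}.
  by apply: continuous_subspaceT => x; apply: cvg_norm; exact: cu.
have [c _ cM] := compact_EVT_max (ex_intro _ point I : [set: T] !=set0) cT cu'.
by exists `|u c| => // x; apply: cM; rewrite inE.
Qed.

Lemma bounded_integrable d (T : measurableType d) (P : probability T R)
    (u : T -> R) (M : R) : measurable_fun setT u -> (forall x, `|u x| <= M) ->
  P.-integrable setT (EFin \o u).
Proof.
move=> mu uM; apply: measurable_bounded_integrable => //.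
  exact: le_lt_trans (probability_le1 P measurableT) (ltry 1).
exists M; split; first by rewrite num_real.
by move=> y My x _ /=; rewrite (le_trans (uM x))// ltW.
Qed.

Lemma continuous_integrable (T : ptopologicalType) (P : probability (borel T) R)
    (u : T -> R) : compact [set: T] -> continuous u ->
  P.-integrable setT (EFin \o (u : borel T -> R)).
Proof.
move=> cT cu; have [M _ uM] := compact_bounded_fun cT cu.
exact: (@bounded_integrable _ (borel T) P u M (continuous_borelR cu) uM).
Qed.

Lemma Rintegral_cst_prob d (T : measurableType d) (P : probability T R) (r : R) :
  \int[P]_x r = r.
Proof. rewrite Rintegral_cst// -[RHS]mulr1; congr (_ * _).
by rewrite -[RHS]/(fine 1%E); congr fine; exact: probability_setT. Qed.

End borel_measurability.

Section seqspace_measurability.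
Context {R : realType} {A : pmetricType R}.
Local Notation Omega := (seqspace A).
Hypothesis cA : compact [set: A].

(** The coordinates generate the whole Borel sigma-algebra of the product because a compact metric
    space has a countable base: an open set is then a countable union of basic cylinders. *)
Lemma measurable_to_seqspace d (X : measurableType d) (F : X -> borel Omega) :
  (forall i, measurable_fun [set: X] (fun t => F t i : borel A)) ->
  measurable_fun [set: X] F.
Proof.
move=> mF; have [B cB [oB Bnbhs]] := compact_second_countable cA.
have /countable_injP[f finj] := cB.
pose b j := xget set0 [set V | B V /\ f V = j].
have ob j : open (b j).
  by rewrite /b; case: xgetP => [V _ [/oB//]|_]; exact: open0.
have bf V : B V -> b (f V) = V.
  move=> BV; rewrite /b; case: xgetP => [W _ [BW fWV]|/(_ V)[]//].
  by apply: finj; rewrite ?inE.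
(* A basic cylinder is coded by a finite list of pairs (coordinate, index of a base set), and there
   are countably many such lists. *)
pose C (s : seq (nat * nat)) : set Omega := [set y | forall q, q \in s -> b q.2 (y q.1)].
have mC s : measurable (F @^-1` C s).
  elim: s => [|q s IH].
    by rewrite (_ : _ @^-1` _ = setT)//; rewrite eqEsubset; split => // t _ q.
  rewrite (_ : _ @^-1` _ = (fun t => F t q.1) @^-1` b q.2 `&` F @^-1` C s).
    apply: measurableI => //; rewrite -[X in measurable X]setTI; apply: mF => //.
    exact: sub_sigma_algebra.
  rewrite eqEsubset; split => [t Ct|t [Ctq Cts] r].
    by split => [|r rs]; apply: Ct; rewrite inE ?eqxx ?rs ?orbT.
  by rewrite inE => /orP[/eqP->//|/Cts].
apply: (@measurability _ _ X (borel Omega) _ _ (@open Omega)) => //.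
move=> _ [U oU <-]; rewrite setTI.
rewrite (_ : F @^-1` U = \bigcup_s (if `[< C s `<=` U >] then F @^-1` C s else set0)).
  apply: countable_bigcupT_measurable => // s.
  by case: ifP => // _; exact: mC.
rewrite eqEsubset; split => [t Ut|t [s _]]; last first.
  by case: asboolP => // CU /CU.
have /nbhs_cylinder[n [V [xV VU]]] : nbhs (F t : Omega) U by exact: open_nbhs_nbhs.
have /choice[W WV] : forall i, exists W, [/\ B W, W (F t i) & W `<=` V i].
  by move=> i; have [W [BW Wt] WV] := Bnbhs _ _ (xV i); exists W.
have WE i : b (f (W i)) = W i by apply: bf; case: (WV i).
pose s := [seq (i, f (W i)) | i <- iota 0 n].
have CsU : C s `<=` U.
  move=> y Csy; apply: VU => i im; case: (WV i) => _ _; apply; rewrite -WE.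
  by apply: (Csy (i, f (W i))); apply/mapP; exists i => //; rewrite mem_iota.
exists s => //; case: asboolP => // _ q /mapP[i _ ->] /=.
by rewrite WE; case: (WV i).
Qed.

End seqspace_measurability.

(** * The Ruelle operator on continuous functions *)

Lemma continuous_dist_le (R : realType) (T : topologicalType) (F : T -> R) :
  (forall x e, 0 < e -> \forall x' \near x, `|F x - F x'| <= e) -> continuous F.
Proof. by move=> h x; apply/cvgrPdist_le => e; exact: h. Qed.

Section pointwise_continuity.
Context {R : realType} {T : topologicalType}.
Implicit Types u v : T -> R.

Lemma continuous_add u v : continuous u -> continuous v -> continuous (fun x => u x + v x).
Proof. by move=> cu cv x; exact: cvgD (cu x) (cv x). Qed.

Lemma continuous_sub u v : continuous u -> continuous v -> continuous (fun x => u x - v x).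
Proof. by move=> cu cv x; exact: cvgB (cu x) (cv x). Qed.

Lemma continuous_opp u : continuous u -> continuous (fun x => - u x).
Proof. by move=> cu x; exact: cvgN (cu x). Qed.

Lemma continuous_mul u v : continuous u -> continuous v -> continuous (fun x => u x * v x).
Proof. by move=> cu cv x; exact: cvgM (cu x) (cv x). Qed.

Lemma continuous_norm u : continuous u -> continuous (fun x => `|u x|).
Proof. by move=> cu x; exact: cvg_norm (cu x). Qed.

Lemma continuous_scale r u : continuous u -> continuous (fun x => r * u x).
Proof. by move=> cu; apply: continuous_mul => // x; exact: cst_continuous. Qed.

Lemma continuous_expR_comp u : continuous u -> continuous (fun x => expR (u x)).
Proof. by move=> cu x; exact: continuous_comp (cu x) (@continuous_expR R (u x)). Qed.

Lemma continuous_ln_comp u : continuous u -> (forall x, 0 < u x) ->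
  continuous (fun x => ln (u x)).
Proof. by move=> cu u0 x; exact: continuous_comp (cu x) (continuous_ln (u0 x)). Qed.

End pointwise_continuity.

Section ruelle_continuous_functions.
Context {R : realType} {A : pmetricType R}.
Local Notation Omega := (seqspace A).
Hypothesis cA : compact [set: A].
Variable p : probability (borel A) R.
Let cO : compact [set: Omega] := seqspace_compact cA.
Implicit Types (f g phi psi u v : Omega -> R) (x : Omega).

Lemma continuous_intD (mu : probability (borel Omega) R) u v :
  continuous u -> continuous v ->
  \int[mu]_x (u x + v x) = \int[mu]_x u x + \int[mu]_x v x.
Proof. by move=> cu cv; rewrite RintegralD//; exact: continuous_integrable. Qed.

Lemma continuous_intB (mu : probability (borel Omega) R) u v :
  continuous u -> continuous v ->
  \int[mu]_x (u x - v x) = \int[mu]_x u x - \int[mu]_x v x.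
Proof. by move=> cu cv; rewrite RintegralB//; exact: continuous_integrable. Qed.

Lemma continuous_intZ (mu : probability (borel Omega) R) r u :
  continuous u -> \int[mu]_x (r * u x) = r * \int[mu]_x u x.
Proof. by move=> cu; rewrite RintegralZl//; exact: continuous_integrable. Qed.

Lemma continuous_le_int (mu : probability (borel Omega) R) u v :
  continuous u -> continuous v -> (forall x, u x <= v x) ->
  \int[mu]_x u x <= \int[mu]_x v x.
Proof.
by move=> cu cv uv; apply: le_Rintegral => //; exact: continuous_integrable.
Qed.

Lemma continuous_gt0_min u : continuous u -> (forall x, 0 < u x) ->
  exists2 c, 0 < c & forall x, c <= u x.
Proof.
move=> cu u0.
have cu' : {within [set: Omega], continuous u} by exact: continuous_subspaceT.
have [c _ cM] := compact_EVT_min (ex_intro _ point I : [set: Omega] !=set0) cO cu'.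
by exists (u c) => // x; apply: cM; rewrite inE.
Qed.

Lemma continuous_shift_comp u : continuous u -> continuous (fun x => u (Defs.shift x)).
Proof.
by move=> cu x; apply: continuous_comp; [exact: shift_continuous|exact: cu].
Qed.

Lemma prepend_continuousl x : continuous (fun a => prepend a x).
Proof.
by apply: continuous_to_seqspace => -[|i] a /=; [exact: cvg_id|exact: cst_continuous].
Qed.

Lemma continuous_prepend_comp u x : continuous u -> continuous (fun a => u (prepend a x)).
Proof.
by move=> cu a; apply: continuous_comp; [exact: prepend_continuousl|exact: cu].
Qed.

Lemma integrable_prepend u x : continuous u ->
  p.-integrable setT (EFin \o (fun a : borel A => u (prepend a x))).
Proof.
by move=> cu; apply: continuous_integrable => //; exact: continuous_prepend_comp.
Qed.

(** By compactness of [A], a single neighbourhood of [x] makes the integrands close for all [a] at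
    once. *)
Lemma prepend_int_continuous u : continuous u ->
  continuous (fun x => \int[p]_a u (prepend a x)).
Proof.
move=> cu; apply: continuous_dist_le => x e e0.
have : \forall x' \near x, [set: A] `<=` (fun a => `|u (prepend a x) - u (prepend a x')| < e).
  have H a : [set: A] a -> \forall a' \near a & x' \near x,
      `|u (prepend a' x) - u (prepend a' x')| < e.
    move=> _.
    have c2 : continuous (fun z : A * Omega => u (prepend z.1 z.2)).
      by move=> z; apply: continuous_comp; [exact: prepend_continuous|exact: cu].
    have e2 : 0 < e / 2 by rewrite divr_gt0.
    have /cvgrPdist_lt/(_ _ e2) h1 := c2 (a, x).
    case: h1 => -[P Q] /= [aP xQ] PQ.
    exists (P, Q) => // -[a' x'] /= [Pa Qx].
    rewrite (splitr e).
    have h1 := PQ (a', x) (conj Pa (nbhs_singleton xQ)).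
    have h2 := PQ (a', x') (conj Pa Qx).
    apply: le_lt_trans (ltrD h1 h2);
    rewrite /= (distrC (u (prepend a x)) (u (prepend a' x))).
    by have := ler_distD (u (prepend a x)) (u (prepend a' x)) (u (prepend a' x')).
  exact: (iffLR (compact_near_coveringP _) cA Omega (nbhs x)
    (fun x' a => `|u (prepend a x) - u (prepend a x')| < e) _ H).
apply: filterS => x' h.
rewrite -RintegralB//; [|exact: integrable_prepend..].
have cd : continuous (fun a => u (prepend a x) - u (prepend a x')).
  by apply: continuous_sub; exact: continuous_prepend_comp.
apply: (le_trans (le_normr_Rintegral _ _)) => //; first exact: continuous_integrable.
rewrite -[leRHS](Rintegral_cst_prob p e); apply: le_Rintegral => //.
- by apply: continuous_integrable => //; exact: continuous_norm.
- by apply: continuous_integrable => // a; exact: cst_continuous.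
- by move=> a _; apply/ltW/h.
Qed.

Lemma ruelle_continuous f phi : continuous f -> continuous phi ->
  continuous (ruelle p f phi).
Proof.
move=> cf cphi.
apply: (@prepend_int_continuous (fun x => expR (f x) * phi x)).
by apply: continuous_mul => //; exact: continuous_expR_comp.
Qed.

Lemma integrable_ruelle f phi x : continuous f -> continuous phi ->
  p.-integrable setT (EFin \o (fun a : borel A =>
    expR (f (prepend a x)) * phi (prepend a x))).
Proof.
move=> cf cphi; apply: (@integrable_prepend (fun x => expR (f x) * phi x)).
by apply: continuous_mul => //; exact: continuous_expR_comp.
Qed.

Lemma le_ruelle f phi psi x : continuous f -> continuous phi -> continuous psi ->
  (forall y, phi y <= psi y) -> ruelle p f phi x <= ruelle p f psi x.
Proof.
move=> cf cphi cpsi h; apply: le_Rintegral => //; [exact: integrable_ruelle..|].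
by move=> a _; rewrite ler_pM2l ?expR_gt0.
Qed.

Lemma ruelleD f phi psi x : continuous f -> continuous phi -> continuous psi ->
  ruelle p f (fun y => phi y + psi y) x = ruelle p f phi x + ruelle p f psi x.
Proof.
move=> cf cphi cpsi; rewrite -RintegralD//; [|exact: integrable_ruelle..].
by apply: eq_Rintegral => a _; rewrite mulrDr.
Qed.

Lemma ruelleZ f phi r x : continuous f -> continuous phi ->
  ruelle p f (fun y => r * phi y) x = r * ruelle p f phi x.
Proof.
move=> cf cphi; rewrite -RintegralZl//; [|exact: integrable_ruelle..].
by apply: eq_Rintegral => a _; rewrite mulrCA.
Qed.

Lemma shift_prepend a x : Defs.shift (prepend a x) = x.
Proof. by []. Qed.

(** All preimages [prepend a x] have the same shift [x], so [psi] is constant under the integral.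
    This is what allows a potential to be normalized by subtracting a function of the shift. *)
Lemma ruelle_shift f phi psi x : continuous f -> continuous phi ->
  ruelle p f (fun y => phi y * psi (Defs.shift y)) x = ruelle p f phi x * psi x.
Proof.
move=> cf cphi; rewrite -RintegralZr//; [|exact: integrable_ruelle..].
by apply: eq_Rintegral => a _; rewrite mulrA.
Qed.

Lemma ruelle_gt0 f phi x : continuous f -> continuous phi ->
  (forall y, 0 < phi y) -> 0 < ruelle p f phi x.
Proof.
move=> cf cphi phi0.
have [||c c0 cle] := @continuous_gt0_min (fun y => expR (f y) * phi y).
- by apply: continuous_mul => //; exact: continuous_expR_comp.
- by move=> y; rewrite mulr_gt0 ?expR_gt0.
rewrite (lt_le_trans c0)// -[leLHS](Rintegral_cst_prob p); apply: le_Rintegral => //.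
- by apply: continuous_integrable => // a; exact: cst_continuous.
- exact: integrable_ruelle.
Qed.

Lemma shift_invariant_int_bounded (mu : probability (borel Omega) R) u (M : R) :
  shift_invariant mu -> measurable_fun [set: borel Omega] (u : borel Omega -> R) ->
  (forall x, `|u x| <= M) -> \int[mu]_x u (Defs.shift x) = \int[mu]_x u x.
Proof.
move=> inv mu_u uM; rewrite /Rintegral; congr fine.
have mshift : measurable_fun [set: borel Omega] (@Defs.shift R A : borel Omega -> borel Omega).
  by apply: continuous_borel; exact: shift_continuous.
transitivity (\int[pushforward mu (@Defs.shift R A : borel Omega -> borel Omega)]_y (u y)%:E)%E.
  rewrite integral_pushforward//.
  - exact/measurable_EFinP.
  - exact: (bounded_integrable mu (measurableT_comp mu_u mshift) (fun x => uM _)).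
by apply: eq_measure_integral => B mB _; exact: inv.
Qed.

Lemma shift_invariant_int (mu : probability (borel Omega) R) u :
  shift_invariant mu -> continuous u -> \int[mu]_x u (Defs.shift x) = \int[mu]_x u x.
Proof.
move=> inv cu; have [M _ uM] := compact_bounded_fun cO cu.
exact: (shift_invariant_int_bounded inv (continuous_borelR cu) uM).
Qed.

End ruelle_continuous_functions.

(** * Fixed points of the transpose *)

Section key_inequality.
Context {R : realType} {A : pmetricType R}.
Local Notation Omega := (seqspace A).
Hypothesis cA : compact [set: A].
Variable p : probability (borel A) R.
Let cO : compact [set: Omega] := seqspace_compact cA.
Implicit Types (f g phi psi u v : Omega -> R) (x : Omega).

(** From [1 - y <= exp (- y)] follows [exp y <= (1 - y)^-1]. Multiplying the right-hand side by
    [1 - y] leaves the excess [y^2 (1 - 2 y)], whence the bound 1/2. *)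
Lemma expR_le_quadratic (y : R) : `|y| <= 2^-1 -> expR y <= 1 + y + 2 * y ^+ 2.
Proof.
move=> yh; have [y1 y2] : - 2^-1 <= y /\ y <= 2^-1 by apply/andP; rewrite -ler_norml.
rewrite -[y in leLHS]opprK expRN.
have h : 1 - y <= expR (- y) by exact: expR_ge1Dx.
have y0 : 0 < 1 - y by lra.
rewrite (le_trans (y := (1 - y)^-1))//.
  by rewrite lef_pV2 ?posrE ?expR_gt0.
rewrite -[leLHS]mul1r ler_pdivrMr//.
have : 0 <= y ^+ 2 * (1 - 2 * y) by rewrite mulr_ge0 ?sqr_ge0//; lra.
have -> : (1 + y + 2 * y ^+ 2) * (1 - y) = 1 + y ^+ 2 * (1 - 2 * y) by ring.
by rewrite lerDl.
Qed.

Lemma ln_le_sub1 (y : R) : 0 < y -> ln y <= y - 1.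
Proof.
by move=> y0; rewrite lerBrDl; apply: le_trans (expR_ge1Dx (ln y)) _; rewrite lnK ?posrE.
Qed.

Lemma Gstar_of_le g (mu : probability (borel Omega) R) : continuous g ->
  (forall x, ruelle p g (cst 1) x = 1) ->
  (forall phi, continuous phi ->
    \int[mu]_x phi x <= \int[mu]_x ln (ruelle p g (fun y => expR (phi y)) x)) ->
  Gstar p g mu.
Proof.
move=> cg g1 h.
(* Both sides are linear in [phi], so the inequality for [- phi] gives equality. *)
suff le phi : continuous phi -> \int[mu]_x phi x <= \int[mu]_x ruelle p g phi x.
  move=> phi cphi; apply/eqP; rewrite eq_le le// andbT.
  have cN : continuous (fun x => -1 * phi x) by exact: continuous_scale.
  have := le _ cN; rewrite continuous_intZ// mulN1r.
  rewrite (_ : \int[mu]_x ruelle p g _ x = - \int[mu]_x ruelle p g phi x).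
    by rewrite lerN2.
  rewrite -[RHS]mulN1r -(continuous_intZ cA _ _ (@ruelle_continuous _ _ cA p _ _ cg cphi)).
  by apply: eq_Rintegral => x _; rewrite ruelleZ.
move=> cphi; have [M M0 phiM] := compact_bounded_fun cO cphi.
have cL := @ruelle_continuous _ _ cA p _ _ cg cphi.
(* With [L = ruelle p g] and [L 1 = 1], the bounds [ln y <= y - 1] and [expR_le_quadratic] give [ln
   (L (exp (t phi))) <= t L phi + 2 t^2 M^2]; after division by [t] the error is linear in [t]. *)
have step t : 0 < t -> t * M <= 2^-1 ->
    \int[mu]_x phi x <= \int[mu]_x ruelle p g phi x + t * (2 * M ^+ 2).
  move=> t0 tM.
  have ctphi : continuous (fun x => t * phi x) by exact: continuous_scale.
  have := h _ ctphi; rewrite continuous_intZ// => /le_trans hh.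
  rewrite -(ler_pM2l t0) mulrDr.
  apply: hh.
  have -> : t * \int[mu]_x ruelle p g phi x + t * (t * (2 * M ^+ 2)) =
      \int[mu]_x (t * ruelle p g phi x + t ^+ 2 * (2 * M ^+ 2)).
    rewrite continuous_intD//; [|exact: continuous_scale|by move=> x; exact: cst_continuous].
    by rewrite continuous_intZ// Rintegral_cst_prob; ring.
  have cexp := continuous_expR_comp ctphi.
  have cLe := @ruelle_continuous _ _ cA p _ _ cg cexp.
  have Le0 x : 0 < ruelle p g (fun y => expR (t * phi y)) x.
    by apply: ruelle_gt0 => // y; exact: expR_gt0.
  apply: continuous_le_int => //.
  - exact: continuous_ln_comp.
  - apply: continuous_add; first exact: continuous_scale.
    by move=> x; exact: cst_continuous.
  move=> x; apply: (le_trans (ln_le_sub1 (Le0 x))); rewrite lerBlDr.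
  rewrite -ruelleZ// -addrA [X in _ <= _ + X]addrC.
  have -> : 1 + t ^+ 2 * (2 * M ^+ 2) =
      ruelle p g (fun y => (1 + t ^+ 2 * (2 * M ^+ 2)) * cst 1 y) x.
    by rewrite ruelleZ ?g1 ?mulr1// => y; exact: cst_continuous.
  have c1 : continuous (fun y : Omega => (1 + t ^+ 2 * (2 * M ^+ 2)) * cst 1 y).
    by apply: continuous_scale => y; exact: cst_continuous.
  rewrite -ruelleD//; apply: le_ruelle => //.
    exact: continuous_add.
  move=> y; rewrite /= mulr1.
  have tphi : `|t * phi y| <= t * M.
    by rewrite normrM gtr0_norm// ler_pM2l.
  apply: (le_trans (expR_le_quadratic (le_trans tphi tM))).
  have : (t * phi y) ^+ 2 <= (t * M) ^+ 2.
    by rewrite -[leLHS]real_normK ?num_real// lerXn2r ?nnegrE// mulr_ge0// ltW.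
  rewrite !exprMn => ?; lra.
apply/ler_addgt0Pr => e e0.
(* Ensures [t M <= 1/2] and an error of at most [e]; the added ones keep the denominators positive
   when [M = 0]. *)
pose t := Num.min (2^-1 / (M + 1)) (e / (2 * M ^+ 2 + 1)).
have M1 : 0 < M + 1 by lra.
have M2 : 0 < 2 * M ^+ 2 + 1 by have := sqr_ge0 M; lra.
have t0 : 0 < t by rewrite lt_min !divr_gt0.
have tM : t * M <= 2^-1.
  apply: (@le_trans _ _ (t * (M + 1))); first by rewrite ler_pM2l//; lra.
  by rewrite -ler_pdivlMr// ge_min lexx.
apply: (le_trans (step t t0 tM)); rewrite lerD2l.
apply: (@le_trans _ _ (t * (2 * M ^+ 2 + 1))); first by rewrite ler_pM2l//; lra.
by rewrite -ler_pdivlMr// ge_min lexx orbT.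
Qed.

(** Gibbs inequality: the operator of [g] maps [exp (k - g)] to that of [k] applied to 1, which is
    1. Hence [exp (k - g)] has [nu]-integral 1, and [k - g <= exp (k - g) - 1] integrates to the
    claim. *)
Lemma Gstar_gibbs g k (nu : probability (borel Omega) R) :
  continuous g -> continuous k -> (forall x, ruelle p k (cst 1) x = 1) ->
  Gstar p g nu -> \int[nu]_x k x <= \int[nu]_x g x.
Proof.
move=> cg ck k1 nug; have cd := continuous_sub ck cg; have ce := continuous_expR_comp cd.
have c1 : continuous (fun _ : Omega => 1 : R) by move=> x; exact: cst_continuous.
rewrite -subr_le0 -continuous_intB//.
apply: (@le_trans _ _ (\int[nu]_x (expR (k x - g x) - 1))).
  apply: continuous_le_int => //; first exact: continuous_sub.
  by move=> x; rewrite lerBrDl expR_ge1Dx.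
rewrite continuous_intB// Rintegral_cst_prob -nug// subr_le0.
rewrite -[leRHS](Rintegral_cst_prob nu) le_eqVlt; apply/orP; left; apply/eqP.
apply: eq_Rintegral => x _; rewrite -(k1 x); apply: eq_Rintegral => a _.
by rewrite -expRD addrC subrK mulr1.
Qed.

End key_inequality.

(** * Hoelder functions for a metric of the product topology *)

Section holder_functions.
Context {R : realType} {A : pmetricType R}.
Local Notation Omega := (seqspace A).
Hypothesis cA : compact [set: A].
Let cO : compact [set: Omega] := seqspace_compact cA.
Variables (d : Omega -> Omega -> R) (dm : metrizes_product d).
Variables (alpha : R) (alpha0 : 0 < alpha) (alpha1 : alpha < 1).
Implicit Types (f g phi psi u v : Omega -> R) (x : Omega).

Lemma metrizes_ball x e : 0 < e -> \forall y \near x, d x y < e.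
Proof. by move=> e0; apply/(metrizes_nbhs dm); exists e. Qed.

Lemma holder_continuous f : holder d alpha f -> continuous f.
Proof.
move=> [C hC]; apply: continuous_dist_le => x e e0.
have C1 : 0 < `|C| + 1 by have := normr_ge0 C; lra.
(* Chosen so that the constant times [del] to the power [alpha] equals [e]; [C] itself could be 0 or
   negative, hence the absolute value and the 1. *)
pose del := (e / (`|C| + 1)) `^ alpha^-1.
have del0 : 0 < del by rewrite powR_gt0// divr_gt0.
apply: filterS (metrizes_ball x del0) => y xy.
have [<-|/eqP xny] := eqVneq x y; first by rewrite subrr normr0 ltW.
have dxy : 0 < d x y.
  by rewrite lt_neqAle (metrizes_ge0 dm) andbT eq_sym; apply/eqP => /(metrizes_eq0 dm).
have da0 : 0 < d x y `^ alpha by exact: powR_gt0.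
have : `|f x - f y| / d x y `^ alpha <= C by apply: hC; exists (x, y).
rewrite ler_pdivrMr// => /le_trans; apply.
have dae : d x y `^ alpha <= e / (`|C| + 1).
  rewrite (_ : e / _ = del `^ alpha).
    by apply: ge0_ler_powR; rewrite ?nnegrE ?ltW.
  by rewrite /del -powRrM mulVf ?gt_eqF// powRr1// divr_ge0// ltW.
apply: (@le_trans _ _ ((`|C| + 1) * d x y `^ alpha)).
  by rewrite ler_wpM2r ?ltW//; have := ler_norm C; lra.
by rewrite mulrC -ler_pdivlMr.
Qed.

Lemma metrizes_continuous x : continuous (d x).
Proof.
apply: continuous_dist_le => y e e0; apply: filterS (metrizes_ball y e0) => z yz.
have h1 := metrizes_triangle dm x y z; have h2 := metrizes_triangle dm x z y.
have h3 := metrizes_sym dm z y; rewrite ler_norml; apply/andP; split; lra.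
Qed.

Lemma metrizes_bounded : exists2 D, 0 < D & forall x y, d x y <= D.
Proof.
have [M M0 dM] := compact_bounded_fun cO (@metrizes_continuous point).
exists (M + M + 1) => [|x y]; first lra.
have h1 := metrizes_triangle dm x point y; have h2 := metrizes_sym dm x point.
have h3 := le_trans (ler_norm _) (dM x); have h4 := le_trans (ler_norm _) (dM y).
lra.
Qed.

(** Split [d] into its powers [alpha] and [1 - alpha]; the second is bounded because [d] is. *)
Lemma lipschitz_holder f k : 0 <= k -> (forall x y, `|f x - f y| <= k * d x y) ->
  holder d alpha f.
Proof.
move=> k0 fk; have [D D0 dD] := metrizes_bounded.
exists (k * D `^ (1 - alpha)) => _ [[x y] /= xny <-].
have dxy : 0 < d x y.
  by rewrite lt_neqAle (metrizes_ge0 dm) andbT eq_sym; apply/eqP => /(metrizes_eq0 dm).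
rewrite ler_pdivrMr ?powR_gt0//; apply: (le_trans (fk x y)).
rewrite -mulrA ler_wpM2l// -[leLHS](powRr1 (ltW dxy)).
rewrite -[1 in leLHS](subrK alpha) powRD; last by rewrite (gt_eqF dxy) implybT.
by rewrite ler_wpM2r ?powR_ge0// ge0_ler_powR ?nnegrE ?(ltW dxy) ?(ltW D0)// subr_ge0 ltW.
Qed.

Lemma metrizes_unif_continuous u : continuous u -> forall e, 0 < e ->
  exists2 del, 0 < del & forall x y, d x y < del -> `|u x - u y| < e.
Proof.
move=> cu e e0; have e2 : 0 < e / 2 by rewrite divr_gt0.
have H x : [set: Omega] x -> \forall x' \near x & del \near 0^'+,
    forall y, d x' y < del -> `|u x' - u y| < e.
  move=> _; have /cvgrPdist_lt/(_ _ e2) := cu x.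
  move=> /(metrizes_nbhs dm)[r r0 xr].
  exists ([set x' | d x x' < r / 2], [set del | del < r / 2]).
    by split; [apply: metrizes_ball; rewrite divr_gt0|apply: nbhs_right_lt; rewrite divr_gt0].
  move=> [x' del] /= [xx' delr] y x'y.
  have h1 : d x x' < r by lra.
  have h2 : d x y < r by have := metrizes_triangle dm x x' y; lra.
  rewrite (splitr e); apply: le_lt_trans (ltrD (xr _ h1) (xr _ h2)).
  by rewrite /= (distrC (u x) (u x')); have := ler_distD (u x) (u x') (u y).
have := iffLR (compact_near_coveringP _) cO R 0^'+
    (fun del x => forall y, d x y < del -> `|u x - u y| < e)
  (at_right_proper_filter 0) H.
move=> N; near (0 : R)^'+ => del; exists del; first by near: del; exact: nbhs_right_gt.
by move=> x y; have /(_ _ x I y) := near N del; apply.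
Unshelve. all: by end_near. Qed.

(* inf-convolution of [u] with a large multiple of the distance *)
Lemma holder_dense u e : continuous u -> 0 < e ->
  exists2 v, holder d alpha v & forall x, `|u x - v x| <= e.
Proof.
move=> cu e0; have [M M0 uM] := compact_bounded_fun cO cu.
have [del del0 udel] := metrizes_unif_continuous cu e0.
(* Moving by [del] or more costs at least [2 M], the largest possible gain in [u]; nearer points
   gain less than [e] by uniform continuity. *)
pose k := 2 * M / del; have k0 : 0 <= k by rewrite divr_ge0 ?mulr_ge0// ltW.
have /choice[v vP] : forall x, exists w, (exists y, w = u y + k * d x y) /\
    forall y, w <= u y + k * d x y.
  move=> x; have cF : {within [set: Omega], continuous (fun y => u y + k * d x y)}.
    apply: continuous_subspaceT; apply: continuous_add => //.
    by apply: continuous_scale; exact: metrizes_continuous.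
  have [c _ cM] := compact_EVT_min (ex_intro _ point I : [set: Omega] !=set0) cO cF.
  by exists (u c + k * d x c); split => [|y]; [exists c|apply: cM; rewrite inE].
have vL x y : v x <= v y + k * d x y.
  have [[z ->] _] := vP y; have [_ /(_ z)] := vP x => /le_trans; apply.
  rewrite -addrA lerD2l -mulrDr ler_wpM2l// addrC; exact: metrizes_triangle dm _ _ _.
exists v.
  apply: (lipschitz_holder k0) => x y; have := vL x y; have := vL y x.
  rewrite (metrizes_sym dm y x) => h1 h2; rewrite ler_norml; apply/andP; split; lra.
move=> x; have [[y vy] /(_ x)] := vP x.
rewrite (metrizes_eq0 dm x x).2// mulr0 addr0 => vu.
rewrite ger0_norm ?subr_ge0// vy.
have [dxy|dxy] := ltP (d x y) del.
  have := udel _ _ dxy; rewrite ltr_norml => /andP[h1 h2].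
  have : 0 <= k * d x y by rewrite mulr_ge0 ?(metrizes_ge0 dm).
  lra.
have : 2 * M <= k * d x y by rewrite /k mulrAC ler_pdivlMr// ler_wpM2l ?mulr_ge0.
have /ler_normlP[h1 h2] := uM x; have /ler_normlP[h3 h4] := uM y.
lra.
Qed.

End holder_functions.

(** * Equilibrium states *)

Section normalization.
Context {R : realType} {A : pmetricType R}.
Local Notation Omega := (seqspace A).
Hypothesis cA : compact [set: A].
Let cO : compact [set: Omega] := seqspace_compact cA.
Variables (d : Omega -> Omega -> R) (dm : metrizes_product d).
Variables (alpha : R) (alpha0 : 0 < alpha) (alpha1 : alpha < 1).
Variable p : probability (borel A) R.
Implicit Types (f g h phi psi u v : Omega -> R) (x : Omega).
Local Notation lam := (lambda d alpha p).
Local Notation eigenfun := (RPF_eigenfunction d alpha p).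

Lemma eigenfun_continuous g h : eigenfun g h -> continuous h.
Proof. by case=> _ hh _ _; exact: (holder_continuous dm alpha0 hh). Qed.

Lemma lambda_gt0 g h : continuous g -> eigenfun g h -> 0 < lam g.
Proof.
move=> cg gh; have ch := eigenfun_continuous gh; case: gh => _ _ h0 hE.
have : 0 < lam g * h point by rewrite -hE; exact: ruelle_gt0.
by rewrite pmulr_lgt0.
Qed.

(* Compare [h] with [u] at a point where [h / u] is maximal. *)
Lemma lambda_le g h u c : continuous g -> eigenfun g h -> continuous u ->
  (forall x, 0 < u x) -> (forall x, ruelle p g u x <= c * u x) -> lam g <= c.
Proof.
move=> cg gh cu u0 uc; have ch := eigenfun_continuous gh; case: gh => _ _ h0 hE.
(* This is [h / u], written in a form whose continuity follows from that of [ln] and [expR]. *)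
have cr : continuous (fun x => h x * expR (- ln (u x))).
  apply: continuous_mul => //; apply: continuous_expR_comp.
  by apply: continuous_opp; exact: continuous_ln_comp.
have rE x : h x * expR (- ln (u x)) = h x / u x by rewrite expRN lnK ?posrE.
have cr' : {within [set: Omega], continuous (fun x => h x * expR (- ln (u x)))}.
  exact: continuous_subspaceT.
have [c0 _ cM] := compact_EVT_max (ex_intro _ point I : [set: Omega] !=set0) cO cr'.
pose M := h c0 / u c0; have M0 : 0 < M by rewrite divr_gt0.
have hM x : h x <= M * u x.
  by rewrite -ler_pdivrMr// -rE /M -rE; apply: cM; rewrite inE.
rewrite -(ler_pM2r (h0 c0)) -hE.
apply: (@le_trans _ _ (ruelle p g (fun x => M * u x) c0)).
  by apply: le_ruelle => //; exact: continuous_scale.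
rewrite ruelleZ//; apply: (@le_trans _ _ (M * (c * u c0))).
  by rewrite ler_pM2l.
by rewrite mulrCA /M divfK ?gt_eqF.
Qed.

Lemma normalized_continuous g h : continuous g -> eigenfun g h ->
  continuous (normalized d alpha p g h).
Proof.
move=> cg gh; have ch := eigenfun_continuous gh; case: gh => _ _ h0 _.
have cl := continuous_ln_comp ch h0.
apply: continuous_sub; last by move=> x; exact: cst_continuous.
apply: continuous_sub; last exact: (continuous_shift_comp cl).
exact: continuous_add.
Qed.

Lemma ruelle_normalized g h phi x : continuous g -> eigenfun g h -> continuous phi ->
  ruelle p (normalized d alpha p g h) phi x =
  (lam g * h x)^-1 * ruelle p g (fun y => h y * phi y) x.
Proof.
move=> cg gh cphi; have ch := eigenfun_continuous gh.
have l0 := lambda_gt0 cg gh; case: gh => _ _ h0 _.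
rewrite -ruelleZ//; last exact: continuous_mul.
apply: eq_Rintegral => a _; rewrite /normalized shift_prepend !expRD !expRN.
rewrite !lnK ?posrE// invfM; ring.
Qed.

Lemma ruelle_normalized1 g h x : continuous g -> eigenfun g h ->
  ruelle p (normalized d alpha p g h) (cst 1) x = 1.
Proof.
move=> cg gh; rewrite ruelle_normalized//; last by move=> y; exact: cst_continuous.
have l0 := lambda_gt0 cg gh.
rewrite (_ : (fun y => _) = h); last by apply/funext => y; rewrite mulr1.
by case: gh => _ _ h0 ->; rewrite mulVf// gt_eqF// mulr_gt0.
Qed.

(** The coboundary [ln h - ln (h o shift)] integrates to 0 under an invariant measure. *)
Lemma normalized_int g h (mu : probability (borel Omega) R) : continuous g ->
  eigenfun g h -> shift_invariant mu ->
  \int[mu]_x normalized d alpha p g h x = \int[mu]_x g x - ln (lam g).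
Proof.
move=> cg gh inv; have ch := eigenfun_continuous gh; case: gh => _ _ h0 _.
have cl := continuous_ln_comp ch h0; have cls := continuous_shift_comp cl.
rewrite /normalized continuous_intB//; last first.
- by move=> x; exact: cst_continuous.
- by apply: continuous_sub => //; exact: continuous_add.
rewrite continuous_intB//; last exact: continuous_add.
by rewrite continuous_intD// (shift_invariant_int cA inv cl) addrK Rintegral_cst_prob.
Qed.

Hypothesis RPF : forall g, holder d alpha g -> exists h, eigenfun g h.
Variables (f : Omega -> R) (f_holder : holder d alpha f).
Variables (h_f : Omega -> R) (h_f_RPF : eigenfun f h_f).
Local Notation fbar := (normalized d alpha p f h_f).
Let cf : continuous f := holder_continuous dm alpha0 f_holder.
Let ch_f : continuous h_f := eigenfun_continuous h_f_RPF.
Let cfbar : continuous fbar := normalized_continuous cf h_f_RPF.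

Lemma variational_entropy_le (mu : probability (borel Omega) R) :
  (variational_entropy d alpha p mu <= (- (\int[mu]_x f x) + ln (lam f))%R%:E)%E.
Proof. by rewrite /variational_entropy; apply: ereal_inf_lbound; exists f. Qed.

(** The infimum is attained at [f]: for a competitor [g], the Gibbs inequality between the
    normalizations of [g] and [f] becomes, by [normalized_int], the comparison of the two members of
    the infimum. *)
Lemma variational_entropy_Gstar (nu : probability (borel Omega) R) :
  shift_invariant nu -> Gstar p fbar nu ->
  variational_entropy d alpha p nu = (- (\int[nu]_x f x) + ln (lam f))%R%:E.
Proof.
move=> inv nuG; apply/eqP; rewrite eq_le variational_entropy_le/=.
apply/ereal_infP => _ [g gH <-]; rewrite lee_fin.
have [h gh] := RPF gH; have cg := holder_continuous dm alpha0 gH.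
have arith (a b a' b' u v : R) : u = a - b -> v = a' - b' -> u <= v -> - a' + b' <= - a + b.
  by move=> -> ->; lra.
exact: arith (normalized_int cg gh inv) (normalized_int cf h_f_RPF inv)
  (Gstar_gibbs cA cfbar (normalized_continuous cg gh)
    (fun x => ruelle_normalized1 x cg gh) nuG).
Qed.

(** Variational principle: taking [g = f] in the infimum bounds every term by [ln (lam f)], and [nu]
    attains this value. *)
Lemma sup_equilibrium (nu : probability (borel Omega) R) :
  shift_invariant nu -> Gstar p fbar nu ->
  ereal_sup [set variational_entropy d alpha p mu + (\int[mu]_x f x)%R%:E
            | mu in @shift_invariant R A]%E = (ln (lam f))%:E.
Proof.
move=> inv nuG; apply/eqP; rewrite eq_le; apply/andP; split.
  apply/ereal_supP => _ [mu _ <-].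
  apply: (le_trans (leeD2r _ (variational_entropy_le mu))).
  by rewrite -EFinD lee_fin addrAC addNr add0r.
apply: ereal_sup_ubound; exists nu => //.
by rewrite variational_entropy_Gstar// -EFinD; congr EFin; rewrite addrAC addNr add0r.
Qed.

Lemma Gstar_equilibrium (nu : probability (borel Omega) R) :
  shift_invariant nu -> Gstar p fbar nu -> equilibrium_state d alpha p f nu.
Proof.
move=> inv nuG; split=> //; rewrite (sup_equilibrium inv nuG).
by rewrite variational_entropy_Gstar// -EFinD; congr EFin; rewrite addrAC addNr add0r.
Qed.

(* The perturbation of [f] in the proof has the eigenvalue of [f], with the
   same eigenfunction; it is only continuous, whence the approximation. *)
Lemma equilibrium_Gstar (nu mu : probability (borel Omega) R) :
  shift_invariant nu -> Gstar p fbar nu ->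
  equilibrium_state d alpha p f mu -> Gstar p fbar mu.
Proof.
move=> inv nuG [muinv muE]; rewrite (sup_equilibrium inv nuG) in muE.
have l0 := lambda_gt0 cf h_f_RPF.
have h0 : forall x, 0 < h_f x by case: h_f_RPF.
have tangent g : holder d alpha g ->
    \int[mu]_x g x - \int[mu]_x f x <= ln (lam g) - ln (lam f).
  move=> gH.
  have : (variational_entropy d alpha p mu <= (- (\int[mu]_x g x) + ln (lam g))%R%:E)%E.
    by rewrite /variational_entropy; apply: ereal_inf_lbound; exists g.
  move=> /(leeD2r (\int[mu]_x f x)%R%:E); rewrite muE -EFinD lee_fin.
  have arith (a b u v : R) : v <= - a + u + b -> a - b <= u - v by lra.
  exact: arith.
apply: (Gstar_of_le cA cfbar) => [x|phi cphi]; first exact: ruelle_normalized1.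
have ce := continuous_expR_comp cphi.
pose L := ruelle p fbar (fun y => expR (phi y)).
have cL : continuous L by exact: ruelle_continuous.
have L0 x : 0 < L x by apply: ruelle_gt0 => // y; exact: expR_gt0.
have cl := continuous_ln_comp cL L0.
have cls := continuous_shift_comp cl.
rewrite -(shift_invariant_int cA muinv cl) -subr_le0 -continuous_intB//.
(* Subtracting [ln L] of the shift divides [ruelle p f (h_f exp phi)] by [L], and this quotient is
   [lam f * h_f] because [fbar] is the normalization of [f] by [h_f]. *)
pose psi x := f x + (phi x - ln (L (Defs.shift x))).
have cpsi : continuous psi by apply: continuous_add => //; exact: continuous_sub.
have psiE x : ruelle p psi h_f x = lam f * h_f x.
  have LE : L x = (lam f * h_f x)^-1 * ruelle p f (fun y => h_f y * expR (phi y)) x.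
    exact: ruelle_normalized.
  have -> : ruelle p psi h_f x = ruelle p f (fun y => h_f y * expR (phi y)) x * (L x)^-1.
    rewrite mulrC -ruelleZ//; last exact: continuous_mul.
    apply: eq_Rintegral => a _; rewrite /psi shift_prepend !expRD expRN lnK ?posrE//.
    ring.
  have X0 : 0 < ruelle p f (fun y => h_f y * expR (phi y)) x.
    apply: ruelle_gt0 => //; first exact: continuous_mul.
    by move=> y; rewrite mulr_gt0 ?expR_gt0.
  by rewrite LE invfM invrK mulrCA mulfV ?mulr1// gt_eqF.
have arith (a b a' b' r : R) : b' + (a - b) - a' <= r -> a - b - r <= a' - b' by lra.
apply/ler_addgt0Pr => e e0; rewrite add0r.
(* One half of [e] pays for the change of [log lambda] from [psi] to [g], the other for the change
   of the integral. *)
have e2 : 0 < e / 2 by rewrite divr_gt0.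
have [g gH psig] := holder_dense cA dm alpha1 cpsi e2.
have [h gh] := RPF gH; have cg := holder_continuous dm alpha0 gH.
(* Since [g <= psi + e / 2], the eigenfunction [h_f] of [psi] is a positive supersolution for [g],
   as [lambda_le] requires. *)
have lg : lam g <= expR (e / 2) * lam f.
  apply: (lambda_le cg gh ch_f h0) => x; rewrite -mulrA -psiE.
  rewrite -(ruelleZ cA p (expR (e / 2)) x cpsi ch_f).
  apply: le_Rintegral => //; first exact: integrable_ruelle.
    apply: (@integrable_ruelle _ _ cA p psi (fun y => expR (e / 2) * h_f y) x) => //.
    exact: continuous_scale.
  move=> a _; rewrite mulrA ler_pM2r//  -expRD ler_expR.
  by have /ler_normlP[] := psig (prepend a x); lra.
have llg : ln (lam g) <= e / 2 + ln (lam f).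
  rewrite -[e / 2 in leRHS]expRK -lnM ?posrE ?expR_gt0//.
  rewrite ler_ln ?posrE; [exact: lg|exact: lambda_gt0 cg gh|].
  by rewrite mulr_gt0 ?expR_gt0.
have t1 : \int[mu]_x (g x - f x) <= e / 2.
  rewrite (continuous_intB cA _ cg cf); apply: (le_trans (tangent _ gH)).
  by rewrite lerBlDr; exact: llg.
have : \int[mu]_x (phi x - ln (L (Defs.shift x)) - e / 2) <= e / 2.
  apply: le_trans t1; apply: continuous_le_int => //.
  - apply: continuous_sub; first exact: continuous_sub.
    by move=> x; exact: cst_continuous.
  - exact: continuous_sub.
  - move=> x; have /ler_normlP[_] := psig x; exact: arith.
have cc : continuous (fun _ : Omega => e / 2) by move=> x; exact: cst_continuous.
rewrite (continuous_intB cA _ (continuous_sub cphi cls) cc).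
by rewrite Rintegral_cst_prob lerBlDr -splitr.
Qed.

End normalization.

(** * The variational formula for the relative entropy *)

Section entropy_inequalities.
Context {R : realType}.
Implicit Types y t : R.

Lemma xlnx_ge y : 0 <= y -> y - 1 <= y * ln y.
Proof.
rewrite le_eqVlt => /predU1P[<-|y0]; first by rewrite mul0r sub0r lerN10.
have y'0 : 0 < y^-1 by rewrite invr_gt0.
have := expR_ge1Dx (ln y^-1); rewrite lnK ?posrE// lnV ?posrE// => h.
have : y * (1 - ln y) <= y * y^-1 by rewrite ler_pM2l.
rewrite mulfV ?gt_eqF// mulrBr mulr1; lra.
Qed.

(** Young inequality for the convex conjugates [y ln y - y] and [exp t]. *)
Lemma young_xlnx y t : 0 <= y -> y * t <= y * ln y - y + expR t.
Proof.
rewrite le_eqVlt => /predU1P[<-|y0].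
  by rewrite !mul0r subr0 add0r expR_ge0.
have h := expR_ge1Dx (t - ln y).
have : y * (1 + (t - ln y)) <= y * expR (t - ln y) by rewrite ler_pM2l.
rewrite expRD expRN lnK ?posrE// mulrCA mulfV ?gt_eqF// mulr1.
by rewrite mulrDr mulr1 mulrBr; lra.
Qed.

End entropy_inequalities.

Section relative_entropy_variational.
Context d (T : measurableType d) (R : realType) (mu nu : probability T R).

Local Open Scope ereal_scope.

(** The integral of [u] may be [+oo], so additivity is used for nonnegative functions only. *)
Lemma integral_add1 (u : T -> R) : measurable_fun setT u -> (forall x, - 1 <= u x)%R ->
  \int[nu]_x (u x + 1)%:E = \int[nu]_x (u x)%:E + 1.
Proof.
move=> mu_ u1; have mE : measurable_fun setT (EFin \o u) by exact/measurable_EFinP.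
have v0 x : (0 <= u x + 1)%R by rewrite -lerBlDr sub0r.
have m1 : measurable_fun setT (fun x => (u x + 1)%:E).
  by apply/measurable_EFinP; exact: measurable_funD.
have mp := measurable_funepos mE; have mn := measurable_funeneg mE.
have neg1 x : (EFin \o u)^\- x <= 1.
  rewrite funenegE /= ge_max lee01 andbT lee_fin.
  by rewrite lerNl.
have int1 : \int[nu]_x (cst 1%:E) x = 1.
  by rewrite integral_cst// mul1e; exact: probability_setT.
have negfin : \int[nu]_x (EFin \o u)^\- x \is a fin_num.
  rewrite ge0_fin_numE ?integral_ge0//; apply: (@le_lt_trans _ _ 1); last exact: ltry.
  by rewrite -int1; apply: ge0_le_integral.
(* The identity [(u + 1) + u^- = u^+ + 1] has nonnegative terms on both sides; the integral of [u^-]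
   is finite and can then be subtracted. *)
have : \int[nu]_x (u x + 1)%:E + \int[nu]_x (EFin \o u)^\- x =
       \int[nu]_x (EFin \o u)^\+ x + 1.
  rewrite -[in RHS]int1 -!ge0_integralD//; last by move=> x _; rewrite lee_fin.
  apply: eq_integral => x _; rewrite funeposE funenegE /= -!EFin_max -!EFinD.
  by congr EFin; have [h1|h1] := lerP (u x) 0; have [h2|h2] := lerP (- u x) 0; lra.
move=> h; rewrite [X in _ = X + _]integralE addeAC -h addeK//.
Qed.

Variable D : T -> R.
Hypotheses (mD : measurable_fun setT D) (D0 : forall x, (0 <= D x)%R).
Hypothesis iD : nu.-integrable setT (EFin \o D).
Hypothesis muD : forall (phi : T -> R) (M : R), measurable_fun setT phi ->
  (forall x, `|phi x| <= M)%R ->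
  (\int[mu]_x phi x = \int[nu]_x (phi x * D x))%R.

Let mDln : measurable_fun setT (fun x => D x * ln (D x))%R.
Proof. by apply: measurable_funM => //; exact: measurableT_comp. Qed.

Let Dln_ge x : (- 1 <= D x * ln (D x))%R.
Proof. by apply: le_trans (xlnx_ge (D0 x)); rewrite lerBrDr addNr. Qed.

Let intD : (\int[nu]_x D x = 1)%R.
Proof.
have := @muD (cst 1%R) 1%R (measurable_cst _) (fun _ => ltac:(by rewrite normr1)).
rewrite Rintegral_cst_prob => ->; apply: eq_Rintegral => x _.
by rewrite mul1r.
Qed.

Let integrable_boundedM (phi : T -> R) (M : R) : measurable_fun setT phi ->
  (forall x, `|phi x| <= M)%R -> nu.-integrable setT (EFin \o (fun x => phi x * D x)%R).
Proof.
move=> mphi phiM; apply: (@le_integrable _ _ _ _ _ _ _ (EFin \o (fun x => M * D x)%R)) => //.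
- by apply/measurable_EFinP; exact: measurable_funM.
- move=> x _; rewrite lee_fin /= !normrM ler_wpM2r//.
  by apply: le_trans (ler_norm _); exact: phiM.
- by have := integrableZl measurableT M iD; under eq_fun do rewrite -EFinM.
Qed.

(* The next two lemmas are the two inequalities of the Donsker-Varadhan formula,
   with the test functions normalized by [int e^phi dnu <= 1]. *)
Lemma entropy_ge (phi : T -> R) (M : R) : measurable_fun setT phi ->
  (forall x, `|phi x| <= M)%R ->
  (\int[nu]_x expR (phi x) <= 1)%R ->
  (\int[mu]_x phi x)%R%:E <= \int[nu]_x (D x * ln (D x))%:E.
Proof.
move=> mphi phiM ephi; have [->|Hlt] := eqVneq (\int[nu]_x (D x * ln (D x))%:E) +oo.
  exact: leey.
(* Adding 1 makes the integrand nonnegative, so that a finite integral means integrability. *)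
have i1 : nu.-integrable setT (EFin \o (fun x => D x * ln (D x) + 1)%R).
  apply/integrableP; split.
    by apply/measurable_EFinP; exact: measurable_funD.
  rewrite (_ : integral _ _ _ = \int[nu]_x (D x * ln (D x) + 1)%:E).
    rewrite integral_add1//.
    by move: Hlt; case: (integral _ _ _) => // r _; rewrite -EFinD ltry.
  apply: eq_integral => x _ /=; rewrite ger0_norm// -lerBlDr sub0r.
  exact: Dln_ge.
have ic1 : nu.-integrable setT (EFin \o (fun _ : T => 1%R)).
  by apply: (@bounded_integrable _ _ _ _ _ 1%R) => // x; rewrite normr1.
have i2 : nu.-integrable setT (EFin \o (fun x => D x * ln (D x))%R).
  have := integrableB measurableT i1 ic1.
  by apply: eq_integrable => // x _ /=; rewrite -EFinB addrK.
have iexp : nu.-integrable setT (EFin \o (fun x => expR (phi x))).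
  apply: (@bounded_integrable _ _ _ _ _ (expR M)); first exact: measurableT_comp.
  move=> x; rewrite ger0_norm ?expR_ge0// ler_expR.
  exact: le_trans (ler_norm _) (phiM x).
rewrite -[leRHS]fineK; last exact: integrable_fin_num i2.
rewrite lee_fin (muD mphi phiM).
have i3 : nu.-integrable setT (EFin \o (fun x => D x * ln (D x) - D x)%R).
  exact: (integrableB measurableT i2 iD).
apply: (@le_trans _ _ (\int[nu]_x (D x * ln (D x) - D x + expR (phi x)))%R).
  apply: le_Rintegral => //; first exact: integrable_boundedM phiM.
    exact: (integrableD measurableT i3 iexp).
  by move=> x _; rewrite mulrC; exact: young_xlnx.
rewrite RintegralD// RintegralB// intD.
rewrite -[leRHS]/(\int[nu]_x (D x * ln (D x)))%R.
by rewrite -addrA gerDl addrC subr_le0.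
Qed.

Lemma entropy_approx (r : R) : r%:E < \int[nu]_x (D x * ln (D x))%:E ->
  exists (phi : T -> R) (M : R), [/\ measurable_fun setT phi,
    (forall x, `|phi x| <= M)%R, (\int[nu]_x expR (phi x) <= 1)%R &
    (r < \int[mu]_x phi x)%R].
Proof.
move=> rH.
(* Nonnegative and increasing to [D ln D + 1], for monotone convergence. The cutoff is at least 1,
   so the logarithm is nonnegative where it acts. *)
pose v (k : nat) x := (D x * ln (Num.min (D x) k.+1%:R) + 1)%R.
have min0 (k : nat) x : (0 <= Num.min (D x) k.+1%:R)%R by rewrite le_min D0 ler0n.
have mmin (k : nat) : measurable_fun setT (fun x => Num.min (D x) k.+1%:R).
  by apply: measurable_minr => //; exact: measurable_cst.
have mv k : measurable_fun setT (v k).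
  apply: measurable_funD => //; apply: measurable_funM => //.
  by apply: measurableT_comp.
have v0 k x : (0 <= v k x)%R.
  rewrite /v /Num.min; case: ifPn => h.
    by have := Dln_ge x; lra.
  rewrite addr_ge0// mulr_ge0// ln_ge0//.
  by rewrite ler1n.
have vnd x : nondecreasing_seq (v ^~ x).
  move=> m n mn; rewrite lerD2r.
  have [->|Dx] := eqVneq (D x) 0%R; first by rewrite !mul0r.
  have Dx0 : (0 < D x)%R by rewrite lt_neqAle eq_sym Dx D0.
  rewrite ler_pM2l// ler_ln ?posrE ?lt_min ?Dx0 ?ltr0n//.
  by rewrite le_min ge_min lexx/= ge_min ler_nat ltnS mn orbT.
have vcvg x : (v k x)%:E @[k --> \oo] --> (D x * ln (D x) + 1)%:E.
  apply: cvg_near_cst; exists (Num.truncn (D x)).+1 => // k /= Dk.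
  congr EFin; rewrite /v min_l//.
  by apply/ltW/(lt_le_trans (truncnS_gt _)); rewrite ler_nat (leq_trans Dk)// leqnSn.
have : \int[nu]_x (v k x)%:E @[k --> \oo] --> \int[nu]_x (D x * ln (D x) + 1)%:E.
  rewrite (_ : (fun x => (_ + 1)%:E) = fun x => limn (fun k => (v k x)%:E)).
    apply: cvg_monotone_convergence => //.
    - by move=> k; exact/measurable_EFinP.
    - by move=> k x _; rewrite lee_fin.
    - by move=> x _ m n mn; rewrite lee_fin; exact: vnd.
  by apply/funext => x; apply/esym/cvg_lim => //; exact: vcvg.
have rH' : (r + 1)%:E < \int[nu]_x (D x * ln (D x) + 1)%:E.
  by rewrite integral_add1// EFinD lteD2rE.
move=> vlim.
have [k hk] : exists k, (r + 1)%:E < \int[nu]_x (v k x)%:E.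
  apply: contrapT => /forallNP h; move: rH'; rewrite -(cvg_lim _ vlim)// ltNge.
  move=> /negP; apply; apply: lime_le; first by apply/cvg_ex; eexists; exact: vlim.
  by apply: nearW => n; rewrite leNgt; apply/negP; exact: h.
have vle x : (v k x <= 1 + k.+1%:R * D x)%R.
  rewrite /v addrC lerD2l mulrC ler_wpM2r//.
  have [->|m0] := eqVneq (Num.min (D x) k.+1%:R) 0%R; first by rewrite ln0.
  have m0' : (0 < Num.min (D x) k.+1%:R)%R by rewrite lt_neqAle eq_sym m0 min0.
  apply/ltW/(lt_le_trans (ln_sublinear m0')).
  by rewrite ge_min lexx orbT.
have ic1 : nu.-integrable setT (EFin \o (fun _ : T => 1%R)).
  by apply: (@bounded_integrable _ _ _ _ _ 1%R) => // x; rewrite normr1.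
have ivD : nu.-integrable setT (EFin \o (fun x => 1 + k.+1%:R * D x)%R).
  apply: (@integrableD _ _ _ _ _ _ (EFin \o (fun _ : T => 1%R))
    (EFin \o (fun x => k.+1%:R * D x)%R)) => //.
  by have := integrableZl measurableT k.+1%:R iD; under eq_fun do rewrite -EFinM.
have iv : nu.-integrable setT (EFin \o v k).
  apply: le_integrable ivD => //; first exact/measurable_EFinP.
  move=> x _; rewrite lee_fin /= ger0_norm// ger0_norm ?vle//.
  exact: le_trans (v0 k x) (vle x).
(* Half of the available gap; the construction of [w] consumes one [delta], and the other keeps the
   final inequality strict. *)
pose delta := ((\int[nu]_x v k x - (r + 1)) / 2)%R.
have delta0 : (0 < delta)%R.
  rewrite divr_gt0// subr_gt0 -lte_fin; apply: lt_le_trans hk _.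
  by rewrite fineK//; exact: integrable_fin_num iv.
have d1 : (0 < 1 + delta)%R by rewrite addr_gt0.
(* A truncated density: the added [delta] keeps it away from 0, so that [ln w] is bounded, and the
   division brings its integral down to at most 1. *)
pose w x := ((Num.min (D x) k.+1%:R + delta) / (1 + delta))%R.
have wnum x : (0 < Num.min (D x) k.+1%:R + delta)%R by rewrite ltr_wpDl.
have w0 x : (0 < w x)%R by rewrite divr_gt0.
have mw : measurable_fun setT w.
  by apply: measurable_funM => //; exact: measurable_funD.
have mphi : measurable_fun setT (fun x => ln (w x)) by exact: measurableT_comp.
pose M := ((k.+1%:R + delta) / (1 + delta) + (1 + delta) / delta)%R.
have a0 : (0 <= (k.+1%:R + delta) / (1 + delta))%R.
  by rewrite divr_ge0 ?ltW// addr_gt0// ltr0n.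
have b0 : (0 <= (1 + delta) / delta)%R by rewrite divr_ge0 ?ltW.
have phiM x : (`|ln (w x)| <= M)%R.
  have h1 : (ln (w x) <= (k.+1%:R + delta) / (1 + delta))%R.
    apply/ltW/(lt_le_trans (ln_sublinear (w0 x))).
    by rewrite /w ler_pM2r ?invr_gt0// lerD2r ge_min lexx orbT.
  have h2 : (- ln (w x) <= (1 + delta) / delta)%R.
    rewrite -lnV ?posrE//; apply/ltW; apply: (lt_le_trans (ln_sublinear _)).
      by rewrite invr_gt0.
    rewrite /w invf_div ler_pM2l// lef_pV2 ?posrE//.
    by rewrite lerDr.
  by rewrite ler_norml /M; apply/andP; split; lra.
exists (fun x => ln (w x)), M; split => //.
- apply: (@le_trans _ _ (\int[nu]_x ((1 + delta)^-1 * (D x + delta)))%R).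
    apply: le_Rintegral => //.
    + apply: (@bounded_integrable _ _ _ _ _ (expR M)); first exact: measurableT_comp.
      move=> x; rewrite ger0_norm ?expR_ge0// ler_expR.
      exact: le_trans (ler_norm _) (phiM x).
    + have icd : nu.-integrable setT (EFin \o (fun _ : T => delta)).
        by apply: (@bounded_integrable _ _ _ _ _ `|delta|) => // x.
      have := integrableZl measurableT (1 + delta)^-1 (integrableD measurableT iD icd).
      by apply: eq_integrable => // x _.
    + move=> x _; rewrite lnK ?posrE// /w mulrC ler_pM2l ?invr_gt0//.
      by rewrite lerD2r ge_min lexx.
  have icd : nu.-integrable setT (EFin \o (fun _ : T => delta)).
    by apply: (@bounded_integrable _ _ _ _ _ `|delta|) => // x.
  rewrite RintegralZl//; last by have := integrableD measurableT iD icd; apply: eq_integrable.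
  by rewrite RintegralD// intD Rintegral_cst_prob mulVf// gt_eqF.
- rewrite (muD mphi phiM).
  (* The normalization of [w] costs [ln (1 + delta) <= delta] pointwise, weighted by [D]; what
     remains integrates to [r + delta]. *)
  apply: (@lt_le_trans _ _ (\int[nu]_x (v k x - (1 + delta * D x)))%R); last first.
    have iD' : nu.-integrable setT (EFin \o (fun x => 1 + delta * D x)%R).
      apply: (@integrableD _ _ _ _ _ _ (EFin \o (fun _ : T => 1%R))
        (EFin \o (fun x => delta * D x)%R)) => //.
      by have := integrableZl measurableT delta iD; under eq_fun do rewrite -EFinM.
    apply: le_Rintegral => //; first exact: (integrableB measurableT iv iD').
      exact: integrable_boundedM phiM.
    move=> x _; rewrite /v opprD addrA addrK.
    have [->|Dx] := eqVneq (D x) 0%R; first by rewrite !(mul0r,mulr0) subr0.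
    have Dx0 : (0 < D x)%R by rewrite lt_neqAle eq_sym Dx D0.
    rewrite [(delta * _)%R]mulrC -mulrBr mulrC ler_pM2r//.
    have m0 : (0 < Num.min (D x) k.+1%:R)%R by rewrite lt_min Dx0 ltr0n.
    rewrite /w ln_div ?posrE// lerB//.
      by rewrite ler_ln ?posrE// lerDl ltW.
    by apply: le_ln1Dx; rewrite (lt_trans _ delta0)// oppr_lt0.
  have iZ : nu.-integrable setT (EFin \o (fun x => delta * D x)%R).
    by have := integrableZl measurableT delta iD; under eq_fun do rewrite -EFinM.
  have iD' : nu.-integrable setT (EFin \o (fun x => 1 + delta * D x)%R).
    by apply: (@integrableD _ _ _ _ _ _ (EFin \o (fun _ : T => 1%R))
      (EFin \o (fun x => delta * D x)%R)).
  have E : (\int[nu]_x (1 + delta * D x) = 1 + delta)%R.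
    by rewrite RintegralD// RintegralZl// intD Rintegral_cst_prob mulr1.
  rewrite RintegralB// E.
  have : (2 * delta = \int[nu]_x v k x - (r + 1))%R by rewrite /delta mulrC divfK.
  have arith (a b c : R) : (0 < b -> 2 * b = a - (c + 1) -> c < a - (1 + b))%R by lra.
  exact: arith.
Qed.

End relative_entropy_variational.

Section density.
Context d (T : measurableType d) (R : realType) (mu nu : probability T R).
Hypothesis munu : mu `<< nu.
Local Open Scope ereal_scope.
(** A version of the density that is finite and nonnegative at every point, as the variational
    lemmas ask; the version [RN] behind [coord_density] agrees with it almost everywhere. *)
Let f := Radon_Nikodym_SigmaFinite.f mu nu.
Let RN := Radon_Nikodym (charge_of_finite_measure mu) nu.

Let f_fin x : f x \is a fin_num. Proof. exact: Radon_Nikodym_SigmaFinite.f_fin_num. Qed.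
Let fE : EFin \o (fine \o f) = f.
Proof. by apply/funext => x /=; rewrite fineK. Qed.

Lemma density_ge0 x : (0 <= fine (f x))%R.
Proof. by rewrite fine_ge0// Radon_Nikodym_SigmaFinite.f_ge0. Qed.

Lemma density_integrable : nu.-integrable setT (EFin \o (fine \o f)).
Proof. by rewrite fE; exact: Radon_Nikodym_SigmaFinite.f_integrable. Qed.

Lemma measurable_density : measurable_fun setT (fine \o f).
Proof. exact/measurable_EFinP/(measurable_int nu density_integrable). Qed.

Let aeRN : ae_eq nu setT f RN.
Proof. exact: ae_eq_Radon_Nikodym_SigmaFinite. Qed.

Lemma int_density (phi : T -> R) (M : R) : measurable_fun setT phi ->
  (forall x, `|phi x| <= M)%R ->
  (\int[mu]_x phi x = \int[nu]_x (phi x * fine (f x)))%R.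
Proof.
move=> mphi phiM; have iphi := bounded_integrable mu mphi phiM.
rewrite /Rintegral; congr fine.
rewrite -(Radon_Nikodym_change_of_variables munu measurableT iphi).
apply: ae_eq_integral => //.
- apply: emeasurable_funM; first exact/measurable_EFinP.
  exact: measurable_int (Radon_Nikodym_integrable _).
- apply/measurable_EFinP; apply: measurable_funM => //; exact: measurable_density.
- apply: filterS aeRN => x /(_ I) fx _; rewrite EFinM fineK//.
  by rewrite fx.
Qed.

Lemma entropy_density :
  \int[nu]_x (fine (RN x) * ln (fine (RN x)))%:E =
  \int[nu]_x (fine (f x) * ln (fine (f x)))%:E.
Proof.
have mln (g : T -> R) : measurable_fun setT g ->
    measurable_fun setT (fun x : T => (g x * ln (g x))%:E).
  move=> mg; apply/measurable_EFinP; apply: measurable_funM => //.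
  exact: measurableT_comp.
apply: ae_eq_integral => //.
- apply: (mln (fine \o RN)); apply/measurable_EFinP.
  rewrite (_ : _ \o _ = RN).
    exact: measurable_int (Radon_Nikodym_integrable _).
  by apply/funext => x /=; rewrite fineK// Radon_Nikodym_fin_num.
- exact: (mln (fine \o f)) measurable_density.
- by apply: filterS aeRN => x /(_ I) -> _.
Qed.

End density.

(** * Relative entropy on a set of coordinates through test functions *)

Section relative_entropy_coordinates.
Context {R : realType} {A : pmetricType R}.
Local Notation Omega := (seqspace A).
Local Notation coord_space := (@coord_space R A).
Implicit Types (mu nu : probability (borel Omega) R) (L : set nat).

Lemma measurable_coord_space L (u : Omega -> R) :
  measurable_fun [set: coord_space L] (u : coord_space L -> R) ->
  measurable_fun [set: borel Omega] (u : borel Omega -> R).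
Proof.
move=> mu; exact: (measurableT_comp mu (@measurable_to_coord_space R A L)).
Qed.

Lemma integral_coord_restr L mu (u : Omega -> \bar R) :
  measurable_fun [set: coord_space L] (u : coord_space L -> \bar R) ->
  (\int[coord_restr L mu]_x u x = \int[mu]_x u x)%E.
Proof.
move=> mu_; rewrite integralE [in RHS]integralE.
have mT := @measurable_to_coord_space R A L.
congr (_ - _)%E.
- apply: (ge0_integral_pushforward mT) => //; first exact: measurable_funepos.
- apply: (ge0_integral_pushforward mT) => //; first exact: measurable_funeneg.
Qed.

Lemma Rintegral_coord_restr L mu (u : Omega -> R) :
  measurable_fun [set: coord_space L] (u : coord_space L -> R) ->
  \int[coord_restr L mu]_x u x = \int[mu]_x u x.
Proof.
by move=> mu_; rewrite /Rintegral integral_coord_restr//; exact/measurable_EFinP.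
Qed.

Lemma relative_entropyE L mu nu : coord_restr L mu `<< coord_restr L nu ->
  relative_entropy L mu nu =
  (\int[coord_restr L nu]_x (fine (Radon_Nikodym_SigmaFinite.f (coord_restr L mu)
                                                       (coord_restr L nu) x) *
   ln (fine (Radon_Nikodym_SigmaFinite.f (coord_restr L mu) (coord_restr L nu) x)))%:E)%E.
Proof.
move=> munu; rewrite /relative_entropy; case: asboolP => // _.
rewrite -entropy_density// integral_coord_restr//.
apply/measurable_EFinP.
have mRN : measurable_fun [set: coord_space L] (fine \o
    Radon_Nikodym (charge_of_finite_measure (coord_restr L mu)) (coord_restr L nu)).
  apply/measurable_EFinP; rewrite (_ : _ \o _ = Radon_Nikodym
    (charge_of_finite_measure (coord_restr L mu)) (coord_restr L nu)).
    exact: measurable_int (Radon_Nikodym_integrable _).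
  by apply/funext => x /=; rewrite fineK// Radon_Nikodym_fin_num.
by apply: measurable_funM => //; exact: measurableT_comp.
Qed.

(** Together with [relative_entropy_approx], this replaces densities by test functions in all later
    estimates, whether or not there is absolute continuity. *)
Lemma relative_entropy_ge L mu nu (phi : Omega -> R) (M : R) :
  measurable_fun [set: coord_space L] (phi : coord_space L -> R) ->
  (forall x, `|phi x| <= M) -> \int[nu]_x expR (phi x) <= 1 ->
  ((\int[mu]_x phi x)%:E <= relative_entropy L mu nu)%E.
Proof.
move=> mphi phiM ephi.
have [munu|nmunu] := pselect (coord_restr L mu `<< coord_restr L nu); last first.
  by rewrite /relative_entropy; case: asboolP => // _; exact: leey.
rewrite relative_entropyE// -(Rintegral_coord_restr mu mphi).
apply: (entropy_ge _ _ _ _ mphi phiM).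
- exact: measurable_density.
- exact: density_ge0.
- exact: density_integrable.
- exact: int_density.
- rewrite (Rintegral_coord_restr nu (u := fun x => expR (phi x)))//.
  exact: measurableT_comp.
Qed.

Lemma relative_entropy_approx L mu nu (r : R) :
  (r%:E < relative_entropy L mu nu)%E ->
  exists (phi : Omega -> R) (M : R), [/\
    measurable_fun [set: coord_space L] (phi : coord_space L -> R),
    forall x, `|phi x| <= M, \int[nu]_x expR (phi x) <= 1 &
    r < \int[mu]_x phi x].
Proof.
have [munu|nmunu] := pselect (coord_restr L mu `<< coord_restr L nu).
  rewrite relative_entropyE// => H.
  have [phi [M [mphi phiM ephi rphi]]] := entropy_approx (measurable_density munu)
    (density_ge0 munu) (density_integrable munu) (int_density munu) H.
  exists phi, M; split => //.
  - rewrite -(Rintegral_coord_restr (L := L) nu (u := fun x => expR (phi x)))//.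
    exact: measurableT_comp.
  - by rewrite -(Rintegral_coord_restr (L := L) mu (u := phi)).
(* Without domination, a multiple of the indicator of a [nu]-null set charged by [mu] has
   exponential integral 1 under [nu] and an arbitrarily large integral under [mu]. *)
move=> _; have [B [mB nuB muB]] : exists B, [/\ measurable (B : set (coord_space L)),
    coord_restr L nu B = 0%E & coord_restr L mu B <> 0%E].
  apply: contrapT => h; apply/nmunu/null_content_dominatesP => B mB nuB.
  by apply: contrapT => muB; apply: h; exists B.
have mB' : measurable (B : set (borel Omega)).
  by have := @measurable_to_coord_space R A L measurableT B mB; rewrite setTI.
have indE (P : probability (borel Omega) R) : \int[P]_x \1_B x = fine (P B).
  by rewrite /Rintegral integral_indic// setIT.
have iB (P : probability (borel Omega) R) : P.-integrable setT (EFin \o (\1_B : borel Omega -> R)).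
  exact: integrable_indic.
have muB0 : 0 < \int[mu]_x \1_B x.
  rewrite indE fine_gt0// (le_lt_trans (probability_le1 _ mB') (ltry _)) andbT.
  by rewrite lt_neqAle measure_ge0 andbT eq_sym; apply/eqP.
have nuB0 : \int[nu]_x \1_B x = 0.
  by rewrite indE (_ : nu B = 0%E).
pose t := (`|r| + 1) / \int[mu]_x \1_B x.
have mind : measurable_fun [set: coord_space L] (\1_B : coord_space L -> R).
  exact: measurable_indic.
exists (fun x => t * \1_B x), `|t|; split.
- by apply: measurable_funM => //; exact: measurable_cst.
- by move=> x; rewrite normrM ler_piMr// indicE; case: (x \in B); rewrite ?normr1 ?normr0.
- have -> : \int[nu]_x expR (t * \1_B x) = \int[nu]_x (1 + (expR t - 1) * \1_B x).
    apply: eq_Rintegral => x _; rewrite indicE; case: (x \in B).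
      by rewrite !mulr1 addrC subrK.
    by rewrite !mulr0 expR0 addr0.
  rewrite RintegralD//.
  + rewrite Rintegral_cst_prob RintegralZl//; last exact: iB.
    by rewrite nuB0 mulr0 addr0.
  + by apply: (@bounded_integrable _ _ _ _ _ 1) => // x; rewrite normr1.
  + by have := integrableZl measurableT (expR t - 1) (iB nu); apply: eq_integrable.
- rewrite RintegralZl//; last exact: iB.
  rewrite /t divfK ?gt_eqF//; apply: (le_lt_trans (ler_norm r)).
  by rewrite ltrDl.
Qed.

Lemma relative_entropy_ge0 L mu nu : (0 <= relative_entropy L mu nu)%E.
Proof.
have := @relative_entropy_ge L mu nu (cst 0) 0 (measurable_cst _).
rewrite Rintegral_cst_prob; apply => [x|]; first by rewrite normr0.
rewrite -[leRHS](Rintegral_cst_prob nu) le_eqVlt; apply/orP; left; apply/eqP.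
by apply: eq_Rintegral => x _; rewrite expR0.
Qed.

(** If the measures coincide, a test function satisfies [int phi <= int (exp phi - 1) <= 0], so no
    positive real lies below the entropy. *)
Lemma relative_entropy_eq L mu nu :
  (forall B : set (borel Omega), measurable B -> mu B = nu B) -> relative_entropy L mu nu = 0%E.
Proof.
move=> munu; apply/eqP; rewrite eq_le relative_entropy_ge0 andbT leNgt; apply/negP.
move=> /relative_entropy_approx[phi [M [mphi phiM]]].
have -> : \int[nu]_x expR (phi x) = \int[mu]_x expR (phi x).
  by rewrite /Rintegral; congr fine; apply: eq_measure_integral => B mB _; exact/esym/munu.
move=> e1; apply/negP; rewrite -leNgt.
have mphi' := measurable_coord_space mphi.
have ie : mu.-integrable setT (EFin \o (fun x => expR (phi x))).
  apply: (@bounded_integrable _ _ _ _ _ (expR M)); first exact: measurableT_comp.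
  move=> x; rewrite ger0_norm ?expR_ge0// ler_expR.
  exact: le_trans (ler_norm _) (phiM x).
have i1 : mu.-integrable setT (EFin \o (fun _ => 1 : R)).
  by apply: (@bounded_integrable _ _ _ _ _ 1) => // x; rewrite normr1.
apply: (@le_trans _ _ (\int[mu]_x (expR (phi x) - 1))).
  apply: le_Rintegral => //; first exact: (bounded_integrable mu mphi' phiM).
    exact: (integrableB measurableT ie i1).
  by move=> x _; rewrite lerBrDl expR_ge1Dx.
by rewrite RintegralB// Rintegral_cst_prob subr_le0.
Qed.

End relative_entropy_coordinates.

(** * The Ruelle operator on measurable functions *)

Lemma continuous_min1 (R : realType) (T : topologicalType) (u : T -> R) :
  continuous u -> continuous (fun x => Num.min 1 (u x)).
Proof.
move=> cu; have c1 : continuous (fun _ : T => 1 : R) by move=> x; exact: cst_continuous.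
have -> : (fun x => Num.min 1 (u x)) = (fun x => 2^-1 * (1 + u x - `|1 - u x|)).
  by apply/funext => x; rewrite minr_absE mulrC.
apply/continuous_scale/continuous_sub; first exact: continuous_add.
exact/continuous_norm/continuous_sub.
Qed.

Section distance_to_set.
Context {R : realType} {A : pmetricType R}.
Local Notation Omega := (seqspace A).
Variables (d : Omega -> Omega -> R) (dm : metrizes_product d).
Variables (C : set Omega) (C0 : C !=set0).

(** For [C] closed, the functions [min 1 (k * dist_set)] are continuous and increase to the
    indicator of the complement of [C]; this carries identities from continuous functions to open
    sets. *)
Definition dist_set (x : Omega) : R := inf [set d x y | y in C].

Let has_inf_dist x : has_inf [set d x y | y in C].
Proof.
split; first by have [y Cy] := C0; exists (d x y), y.
by exists 0 => _ [y _ <-]; exact: metrizes_ge0 dm _ _.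
Qed.

Lemma dist_set_ge0 x : 0 <= dist_set x.
Proof.
apply: lb_le_inf; first by have [] := has_inf_dist x.
by move=> _ [y _ <-]; exact: metrizes_ge0 dm _ _.
Qed.

Lemma dist_set_in x : C x -> dist_set x = 0.
Proof.
move=> Cx; apply/eqP; rewrite eq_le dist_set_ge0 andbT.
rewrite -((metrizes_eq0 dm x x).2 erefl); apply: ge_inf; last by exists x.
by have [] := has_inf_dist x.
Qed.

Lemma dist_set_lip x y : dist_set x <= d x y + dist_set y.
Proof.
rewrite -lerBlDl; apply: lb_le_inf; first by have [] := has_inf_dist y.
move=> _ [z Cz <-]; rewrite lerBlDl.
apply: le_trans (metrizes_triangle dm x y z); apply: ge_inf; last by exists z.
by have [] := has_inf_dist x.
Qed.

Lemma dist_set_continuous : continuous dist_set.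
Proof.
apply: continuous_dist_le => x e e0; apply: filterS (metrizes_ball dm x e0) => y xy.
have h1 := dist_set_lip x y; have h2 := dist_set_lip y x.
have h3 := metrizes_sym dm x y; rewrite ler_norml; apply/andP; split; lra.
Qed.

Lemma dist_set_gt0 x : open (~` C) -> ~ C x -> 0 < dist_set x.
Proof.
move=> oC nCx; have /(metrizes_nbhs dm)[e e0 xe] : nbhs x (~` C).
  exact: open_nbhs_nbhs.
apply: lt_le_trans e0 _; apply: lb_le_inf; first by have [] := has_inf_dist x.
by move=> _ [z Cz <-]; rewrite leNgt; apply/negP => /xe /=; exact.
Qed.

End distance_to_set.

Section transfer_operator_measurable.
Context {R : realType} {A : pmetricType R}.
Local Notation Omega := (seqspace A).
Hypothesis cA : compact [set: A].
Let cO : compact [set: Omega] := seqspace_compact cA.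
Variables (d : Omega -> Omega -> R) (dm : metrizes_product d).
Variable p : probability (borel A) R.
Variables (g : Omega -> R) (cg : continuous g).
Variables (nu : probability (borel Omega) R) (nuG : Gstar p g nu).
Local Open Scope ereal_scope.
Implicit Types G : Omega -> \bar R.

Definition prepend_pair (z : borel A * borel Omega) : borel Omega := prepend z.1 z.2.

Lemma measurable_prepend_pair : measurable_fun setT prepend_pair.
Proof.
apply: (measurable_to_seqspace cA) => -[|i]; first exact: measurable_fst.
apply: (@measurableT_comp _ _ _ _ _ _ (fun x : borel Omega => x i : borel A)).
  by apply: continuous_borel; exact: proj_seq_continuous.
exact: measurable_snd.
Qed.

Let prepend_mfun : {mfun (borel A * borel Omega)%type >-> borel Omega} :=
  MeasurableFun.Pack (MeasurableFun.Class
    (isMeasurableFun.Build _ _ _ _ prepend_pair measurable_prepend_pair)).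

(** The Ruelle operator on nonnegative extended-real functions, where Tonelli's theorem applies
    without integrability. *)
Definition transfer G (x : Omega) : \bar R :=
  \int[p]_a ((expR (g (prepend a x)))%:E * G (prepend a x)).

Let w (x : borel Omega) : \bar R := (expR (g x))%:E.
Let mw : measurable_fun setT w.
Proof.
apply/measurable_EFinP; apply: continuous_borelR; exact: continuous_expR_comp.
Qed.
Let w0 x : 0 <= w x. Proof. by rewrite lee_fin expR_ge0. Qed.

Lemma transfer_ge0 G x : (forall y, 0 <= G y) -> 0 <= transfer G x.
Proof. by move=> G0; apply: integral_ge0 => a _; rewrite mule_ge0// w0. Qed.

Let mGprep G : measurable_fun [set: borel Omega] (G : borel Omega -> \bar R) ->
  measurable_fun setT ((w \* (G : borel Omega -> \bar R)) \o prepend_pair).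
Proof.
move=> mG; apply: measurableT_comp; last exact: measurable_prepend_pair.
exact: emeasurable_funM.
Qed.

Lemma measurable_transfer G : (forall y, 0 <= G y) ->
  measurable_fun [set: borel Omega] (G : borel Omega -> \bar R) ->
  measurable_fun [set: borel Omega] (transfer G : borel Omega -> \bar R).
Proof.
move=> G0 mG.
have wG0 z : 0 <= ((w \* (G : borel Omega -> \bar R)) \o prepend_pair) z.
  by rewrite mule_ge0// w0.
exact: (@measurable_fun_fubini_tonelli_G _ _ (borel A) (borel Omega) R p _ (mGprep mG) wG0).
Qed.

(** The law of [prepend a x] for independent [a] and [x]. In these terms, a fixed point [nu] of the
    transpose is a measure with density [exp g] with respect to [kappa]. *)
Let kappa := distribution (p \x nu)%E prepend_mfun.

Lemma integral_kappa G : (forall y, 0 <= G y) ->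
  measurable_fun [set: borel Omega] (G : borel Omega -> \bar R) ->
  \int[kappa]_x (w x * G x) = \int[nu]_x transfer G x.
Proof.
move=> G0 mG.
have wG0 z : 0 <= ((w \* (G : borel Omega -> \bar R)) \o prepend_pair) z.
  by rewrite mule_ge0// w0.
rewrite (ge0_integral_pushforward measurable_prepend_pair)//.
- by rewrite preimage_setT (@fubini_tonelli2 _ _ (borel A) (borel Omega) R p nu _ (mGprep mG) wG0).
- exact: emeasurable_funM.
- by move=> x _; rewrite mule_ge0// w0.
Qed.

Lemma transfer_EFin (phi : Omega -> R) x : continuous phi ->
  transfer (EFin \o phi) x = (ruelle p g phi x)%:E.
Proof.
move=> cphi; rewrite -[LHS]fineK; last first.
  exact: integrable_fin_num (integrable_ruelle cA p x cg cphi).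
by [].
Qed.

Let kappa_continuous (phi : Omega -> R) : continuous phi -> (forall x, 0 <= phi x)%R ->
  \int[nu]_x (phi x)%:E = \int[kappa]_x (w x * (phi x)%:E).
Proof.
move=> cphi phi0; rewrite (@integral_kappa (EFin \o phi)).
- under [RHS]eq_integral do rewrite transfer_EFin//.
  rewrite -[LHS]fineK; last exact: integrable_fin_num (continuous_integrable nu cO cphi).
  rewrite -[RHS]fineK; last first.
    exact: integrable_fin_num (continuous_integrable nu cO (ruelle_continuous cA (p:=p) cg cphi)).
  by congr EFin; exact/esym/nuG.
- by move=> x; rewrite lee_fin.
- by apply/measurable_EFinP; exact: continuous_borelR.
Qed.

Let kappa_open (U : set Omega) : open U ->
  nu (U : set (borel Omega)) = \int[kappa]_(x in (U : set (borel Omega))) w x.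
Proof.
move=> oU; have mU : measurable (U : set (borel Omega)) by exact: sub_sigma_algebra.
have -> : \int[kappa]_(x in (U : set (borel Omega))) w x = \int[kappa]_x (w x * (\1_U x)%:E).
  by rewrite integral_mkcond; apply: eq_integral => x _; rewrite patchE indicE;
    case: ifP; rewrite ?mule1 ?mule0.
rewrite -(setIT U) -integral_indic//.
(* The distance to the complement makes sense only if the complement is nonempty; the whole space is
   treated with the constant 1. *)
have [UT|UT] := pselect (~` U !=set0); last first.
  have -> : U = setT
    by apply/seteqP; split => // x _; apply: contrapT => nUx; apply: UT; exists x.
  rewrite setIT;
  have := @kappa_continuous (fun=> 1%R) (fun x => @cst_continuous _ _ _ x)
    (fun _ => ler01).
  rewrite (_ : (fun x => (\1_setT x)%:E) = fun=> 1%E)//.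
    by move=> ->; apply: eq_integral => x _; rewrite indicE in_setT.
  by apply/funext => x; rewrite indicE in_setT.
rewrite setIT.
pose psi (k : nat) x := Num.min 1%R (k%:R * dist_set d (~` U) x)%R.
have cpsi k : continuous (psi k).
  apply: (@continuous_min1 _ _ (fun x => k%:R * dist_set d (~` U) x)%R).
  exact: continuous_scale (dist_set_continuous dm UT).
have psi0 k x : (0 <= psi k x)%R by rewrite le_min ler01 mulr_ge0// dist_set_ge0.
have psind x : nondecreasing_seq (psi ^~ x).
  move=> m n mn; rewrite le_min !ge_min lexx /=.
  by rewrite ler_wpM2r ?orbT// ?dist_set_ge0// ler_nat.
have psicvg x : (psi k x)%:E @[k --> \oo] --> (\1_U x : R)%:E.
  have [Ux|Ux] := pselect (U x); last first.
    rewrite indicE memNset//; apply: cvg_near_cst; apply: nearW => k.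
    by rewrite /psi dist_set_in// mulr0 min_r.
  have d0 : (0 < dist_set d (~` U) x)%R by apply: dist_set_gt0 => //; rewrite setCK.
  rewrite indicE mem_set//; apply: cvg_near_cst.
  exists (Num.truncn (dist_set d (~` U) x)^-1).+1 => // k /= dk.
  congr EFin; rewrite /psi min_l// -ler_pdivrMr// mul1r.
  by apply/ltW/(lt_le_trans (truncnS_gt _)); rewrite ler_nat.
have mpsi k : measurable_fun [set: borel Omega] (psi k : borel Omega -> R) by exact: continuous_borelR.
have l1 : \int[nu]_x (psi k x)%:E @[k --> \oo] --> \int[nu]_x (\1_U x)%:E.
  rewrite (_ : (fun x => (\1_U x)%:E) = fun x => limn (fun k => (psi k x)%:E)).
    apply: cvg_monotone_convergence => //.
    - by move=> k; exact/measurable_EFinP.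
    - by move=> k x _; rewrite lee_fin.
    - by move=> x _ m n mn; rewrite lee_fin; exact: psind.
  by apply/funext => x; apply/esym/cvg_lim => //; exact: psicvg.
have l2 : \int[kappa]_x (w x * (psi k x)%:E) @[k --> \oo] --> \int[kappa]_x (w x * (\1_U x)%:E).
  rewrite (_ : (fun x => w x * (\1_U x)%:E) = fun x => limn (fun k => w x * (psi k x)%:E)).
    apply: cvg_monotone_convergence => //.
    - by move=> k; apply: emeasurable_funM => //; exact/measurable_EFinP.
    - by move=> k x _; rewrite mule_ge0 ?w0// lee_fin.
    - by move=> x _ m n mn; rewrite lee_wpmul2l ?w0// lee_fin; exact: psind.
  by apply/funext => x; apply/esym/cvg_lim => //; apply: cvgeZl => //; exact: psicvg.
have E : (fun k => \int[nu]_x (psi k x)%:E) = fun k => \int[kappa]_x (w x * (psi k x)%:E).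
  by apply/funext => k; exact: kappa_continuous.
by rewrite E in l1; exact: cvg_unique l1 l2.
Qed.

(** The open sets form a pi-system generating the Borel sets; complements are handled by cancelling
    the finite value [nu S]. *)
Let kappa_density (B : set (borel Omega)) : measurable B -> nu B = \int[kappa]_(x in B) w x.
Proof.
move=> mB; move: B mB.
apply: (@dynkin_induction _ (borel Omega) (@open Omega)
  (fun B => nu B = \int[kappa]_(x in B) w x)) => //.
- exact: openI.
- by apply: kappa_open; exact: openT.
- move=> S mS nuS; have mSC := measurableC mS.
  have fS : nu S \is a fin_num by exact: fin_num_measure.
  have := kappa_open openT; rewrite -[X in nu X = integral _ X _](setUv S).
  rewrite measureU//; last by rewrite setICr.
  rewrite ge0_integral_setU//; last 2 first.
  + exact: measurable_funTS.
  + by apply/disj_set2P; rewrite setICr.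
  rewrite -nuS => h.
  have cancel (a b c : \bar R) : a \is a fin_num -> a + b = a + c -> b = c.
    by move=> fa abc; rewrite -[LHS](addeK b fa) (addeC b) abc (addeC a) addeK.
  exact: cancel fS h.
- move=> F mF tF IH; rewrite ge0_integral_bigcup//; last exact: measurable_funTS.
  rewrite (measure_bigcup nu setT F)//.
  rewrite (@eq_eseriesl _ _ xpredT) => [|k]; last by rewrite in_setT.
  by apply: eq_eseriesr => k _; exact: IH.
Qed.

(** [kappa_density] shows that [exp g] and the Radon-Nikodym derivative of [nu] have the same
    integral over each measurable set, hence agree almost everywhere; the change of variables then
    passes to functions. *)
Lemma integral_transfer G : (forall y, 0 <= G y) ->
  measurable_fun [set: borel Omega] (G : borel Omega -> \bar R) ->
  \int[nu]_x transfer G x = \int[nu]_x G x.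
Proof.
move=> G0 mG; rewrite -integral_kappa//.
have nk : nu `<< kappa.
  apply/null_content_dominatesP => B mB kB; rewrite kappa_density//.
  by apply: null_set_integral => //; exact: measurable_funTS.
have wint : kappa.-integrable setT w.
  apply/integrableP; split=> //.
  under eq_integral do rewrite gee0_abs//.
  by rewrite -kappa_density// (le_lt_trans (probability_le1 _ _))// ltry.
rewrite -(Radon_Nikodym_SigmaFinite.change_of_variables nk G0 measurableT mG).
apply: ae_eq_integral => //.
- exact: emeasurable_funM.
- apply: emeasurable_funM => //.
  exact: measurable_int (Radon_Nikodym_SigmaFinite.f_integrable nk).
- have : ae_eq kappa setT w (Radon_Nikodym_SigmaFinite.f nu kappa).
    apply: integral_ae_eq => //.
      exact: measurable_int (Radon_Nikodym_SigmaFinite.f_integrable nk).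
    by move=> E _ mE; rewrite -kappa_density// -Radon_Nikodym_SigmaFinite.f_integral.
  by apply: filterS => x /(_ I) -> _; rewrite muleC.
Qed.

End transfer_operator_measurable.

(** * Iterates of the operator and their distortion *)

Section transfer_iterates.
Context {R : realType} {A : pmetricType R}.
Local Notation Omega := (seqspace A).
Hypothesis cA : compact [set: A].
Let cO : compact [set: Omega] := seqspace_compact cA.
Variables (d : Omega -> Omega -> R) (dm : metrizes_product d).
Variable p : probability (borel A) R.
Variables (g : Omega -> R) (cg : continuous g).
Variables (nu : probability (borel Omega) R) (nuG : Gstar p g nu).
Variables (v : nat -> R).
Hypothesis gv : forall k x y, agree k x y -> `|g x - g y| <= v k.
Local Open Scope ereal_scope.
Implicit Types G : Omega -> \bar R.
Local Notation T := (transfer p g).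
Local Notation mfunO := (fun G => measurable_fun [set: borel Omega] (G : borel Omega -> \bar R)).

Lemma measurable_iter_transfer n G : (forall y, 0 <= G y) -> mfunO G ->
  (forall y, 0 <= iter n T G y) /\ mfunO (iter n T G).
Proof.
move=> G0 mG; elim: n => [//|n [IH0 IHm]]; split.
  by move=> y; exact: transfer_ge0.
exact: (measurable_transfer cA p cg IH0 IHm).
Qed.

Lemma integral_iter_transfer n G : (forall y, 0 <= G y) -> mfunO G ->
  \int[nu]_x iter n T G x = \int[nu]_x G x.
Proof.
move=> G0 mG; elim: n => [//|n IH].
have [h0 hm] := measurable_iter_transfer n G0 mG.
by rewrite -IH -(integral_transfer cA dm cg nuG h0 hm).
Qed.

Let measurable_prep G x : mfunO G -> measurable_fun setT
  (fun a : borel A => (expR (g (prepend a x)))%:E * G (prepend a x)).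
Proof.
move=> mG; have mp : measurable_fun [set: borel A] (fun a : borel A => prepend a x : borel Omega).
  by apply: continuous_borel; exact: prepend_continuousl.
apply: emeasurable_funM; last exact: (measurableT_comp mG mp).
apply/measurable_EFinP.
by apply: (measurableT_comp (continuous_borelR (continuous_expR_comp cg)) mp).
Qed.

Lemma transfer_shift G (eta : Omega -> R) x : (forall y, 0 <= G y) -> mfunO G ->
  (forall y, 0 <= eta y)%R ->
  T (fun y => G y * (eta (Defs.shift y))%:E) x = T G x * (eta x)%:E.
Proof.
move=> G0 mG eta0; rewrite /transfer -ge0_integralZr//.
- by apply: eq_integral => a _; rewrite shift_prepend muleA.
- exact: measurable_prep.
- by move=> a _; rewrite mule_ge0// lee_fin expR_ge0.
- by rewrite lee_fin.
Qed.

Lemma iter_transfer_shift n G (eta : Omega -> R) : (forall y, 0 <= G y) -> mfunO G ->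
  (forall y, 0 <= eta y)%R ->
  iter n T (fun y => G y * (eta (iter n (@Defs.shift R A) y))%:E) =
  fun x => iter n T G x * (eta x)%:E.
Proof.
elim: n G => [|n IH] G G0 mG eta0; first by [].
rewrite iterSr.
rewrite (_ : T _ = fun x => T G x * (eta (iter n (@Defs.shift R A) x))%:E); last first.
  apply/funext => x; rewrite -(@transfer_shift G (fun y => eta (iter n (@Defs.shift R A) y)))//.
  congr (T _ x).
  by apply/funext => y; rewrite iterSr.
rewrite IH//; last exact: (measurable_transfer cA p cg G0 mG).
- by apply/funext => x; rewrite iterSr.
- by move=> y; exact: transfer_ge0.
Qed.

(** Prepending the same symbol to two points that agree on [n] coordinates gives points that agree
    on [n.+1]. Each application of the operator thus asks for one coordinate less, at the price
    [v n.+1]; after [n] applications nothing is asked. *)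
Lemma iter_transfer_compare n G (K : R) : (forall y, 0 <= G y) -> mfunO G ->
  (forall x y, agree n x y -> G x <= (expR K)%:E * G y) ->
  forall x y, iter n T G x <= (expR (K + \sum_(k < n) v k.+1))%:E * iter n T G y.
Proof.
elim: n G K => [|n IH] G K G0 mG GK x y.
  by rewrite big_ord0 addr0; exact: GK.
have TG0 z : 0 <= T G z by exact: transfer_ge0.
have mTG : mfunO (T G) by exact: measurable_transfer.
rewrite iterSr big_ord_recr /= addrA addrAC.
apply: IH => // {}x {}y xy.
rewrite -ge0_integralZl//; last 2 first.
- exact: measurable_prep.
- by move=> a _; rewrite mule_ge0// lee_fin expR_ge0.
apply: ge0_le_integral => //.
- by move=> a _; rewrite mule_ge0// lee_fin expR_ge0.
- exact: measurable_prep.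
- by apply: measurable_funeM; exact: measurable_prep.
move=> a _.
have axy : agree n.+1 (prepend a x) (prepend a y).
  by move=> [|i] //; rewrite ltnS => /xy.
have h1 : (expR (g (prepend a x)) <= expR (v n.+1) * expR (g (prepend a y)))%R.
  rewrite -expRD ler_expR -lerBlDr; exact: le_trans (ler_norm _) (gv axy).
apply: (@le_trans _ _ ((expR (v n.+1) * expR (g (prepend a y)))%:E *
    ((expR K)%:E * G (prepend a y)))).
  by apply: lee_pmul; rewrite ?lee_fin ?expR_ge0//; exact: GK.
by rewrite expRD !EFinM -!muleA (muleCA (expR (g (prepend a y)))%:E) muleCA.
Qed.

(* Integrating out the first [n] coordinates of [nu] amounts to applying the
   [n]-th iterate of the operator, which is comparable at any two points. *)
Lemma quasi_bernoulli n (phi psi : Omega -> R) (M N : R) :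
  measurable_fun [set: borel Omega] (phi : borel Omega -> R) -> (forall x, `|phi x| <= M)%R ->
  (forall x y, agree n x y -> phi x = phi y) ->
  measurable_fun [set: borel Omega] (psi : borel Omega -> R) -> (forall x, `|psi x| <= N)%R ->
  (\int[nu]_x expR (phi x + psi (iter n (@Defs.shift R A) x)) <=
   expR (\sum_(k < n) v k.+1) * (\int[nu]_x expR (phi x) * \int[nu]_x expR (psi x)))%R.
Proof.
move=> mphi phiM phin mpsi psiN.
have mexp (u : Omega -> R) : measurable_fun [set: borel Omega] (u : borel Omega -> R) ->
    measurable_fun [set: borel Omega] (fun x : borel Omega => expR (u x)).
  by move=> mu; exact: measurableT_comp.
have iexp (u : Omega -> R) (K : R) : measurable_fun [set: borel Omega] (u : borel Omega -> R) ->
    (forall x, `|u x| <= K)%R -> nu.-integrable setT (EFin \o (fun x => expR (u x))).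
  move=> mu uK; apply: (@bounded_integrable _ _ _ _ _ (expR K)); first exact: mexp.
  by move=> x; rewrite ger0_norm ?expR_ge0// ler_expR (le_trans (ler_norm _)).
have mS : measurable_fun [set: borel Omega] (iter n (@Defs.shift R A) : borel Omega -> borel Omega).
  by apply: continuous_borel; exact: iter_shift_continuous.
have mpsiS := measurableT_comp mpsi mS.
have i3 : nu.-integrable setT (EFin \o (fun x => expR (phi x + psi (iter n (@Defs.shift R A) x)))).
  apply: (@iexp (fun x => phi x + psi (iter n (@Defs.shift R A) x))%R (M + N)%R).
    exact: measurable_funD.
  by move=> x; rewrite (le_trans (ler_normD _ _))// lerD.
pose G x : \bar R := (expR (phi x))%:E.
have G0 y : 0 <= G y by rewrite lee_fin expR_ge0.
have mG : mfunO G by apply/measurable_EFinP; exact: mexp.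
have cmp := @iter_transfer_compare n G 0%R G0 mG _.
have {cmp}cmp : forall x y, iter n T G x <= (expR (\sum_(k < n) v k.+1))%:E * iter n T G y.
  move=> x y; have := cmp _ x y; rewrite add0r; apply => {}x {}y /phin xy.
  by rewrite expR0 mul1e /G xy.
set c := (\sum_(k < n) v k.+1)%R in cmp *.
have [h0 hm] := measurable_iter_transfer n G0 mG.
(* Average the comparison over [y]: [nu] preserves the integral under the iterates. *)
have cmpJ x : iter n T G x <= (expR c)%:E * \int[nu]_y G y.
  rewrite -(integral_iter_transfer n G0 mG) -ge0_integralZl//.
  have -> : iter n T G x = \int[nu]_y cst (iter n T G x) y.
    rewrite integral_cst// -[LHS]mule1; congr (_ * _); exact/esym/probability_setT.
  apply: ge0_le_integral => //.
  - by move=> y _; exact: h0.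
  - exact: measurable_funeM.
  - by move=> y _; exact: cmp.
have key : \int[nu]_x (expR (phi x + psi (iter n (@Defs.shift R A) x)))%:E <=
    ((expR c)%:E * \int[nu]_y G y) * \int[nu]_x (expR (psi x))%:E.
  have -> : \int[nu]_x (expR (phi x + psi (iter n (@Defs.shift R A) x)))%:E =
      \int[nu]_x (iter n T G x * (expR (psi x))%:E).
    rewrite -(@iter_transfer_shift n G (fun x => expR (psi x))) ?integral_iter_transfer//.
    - by apply: eq_integral => x _; rewrite expRD.
    - by move=> y; rewrite mule_ge0// lee_fin expR_ge0.
    - by apply: emeasurable_funM => //; apply/measurable_EFinP; exact: mexp.
  rewrite -ge0_integralZl//; last 2 first.
  - by apply/measurable_EFinP; exact: mexp.
  - by rewrite mule_ge0 ?lee_fin ?expR_ge0//; exact: integral_ge0.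
  have mepsi : mfunO (fun x => (expR (psi x))%:E) by apply/measurable_EFinP; exact: mexp.
  apply: ge0_le_integral => //.
  - by move=> x _; rewrite mule_ge0// lee_fin expR_ge0.
  - exact: emeasurable_funM.
  - exact: measurable_funeM.
  - by move=> x _; rewrite lee_wpmul2r// lee_fin expR_ge0.
rewrite -lee_fin /Rintegral !EFinM !fineK.
- by rewrite muleA.
- exact: integrable_fin_num (iexp _ _ mpsi psiN).
- exact: integrable_fin_num (iexp _ _ mphi phiM).
- exact: integrable_fin_num i3.
Qed.

End transfer_iterates.

(** * Growth of the relative entropy *)

Section oscillation.
Context {R : realType} {A : pmetricType R}.
Local Notation Omega := (seqspace A).
Hypothesis cA : compact [set: A].
Let cO : compact [set: Omega] := seqspace_compact cA.

Lemma oscillation (u : Omega -> R) : continuous u -> exists v : nat -> R,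
  [/\ forall k, 0 <= v k, forall k x y, agree k x y -> `|u x - u y| <= v k &
      v @ \oo --> 0].
Proof.
move=> cu; have [M M0 uM] := compact_bounded_fun cO cu.
pose S k := [set r | exists x y, agree k x y /\ r = `|u x - u y|].
have S0 k : S k 0 by exists point, point; rewrite subrr normr0.
have Sub k : ubound (S k) (M + M).
  by move=> _ [x [y [_ ->]]]; rewrite (le_trans (ler_normB _ _))// lerD.
have hs k : has_sup (S k) by split; [exists 0|exists (M + M)].
have v0 k : 0 <= sup (S k) by apply: ub_le_sup => //; exact: (hs k).2.
exists (fun k => sup (S k)); split => //.
- by move=> k x y xy; apply: ub_le_sup; [exact: (hs k).2|exists x, y].
- apply/cvgrPdist_le => e e0; have := agree_uniform cA cu e0.
  apply: filterS => k h; rewrite sub0r normrN ger0_norm//.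
  by apply: ge_sup; [exists 0|move=> _ [x [y [xy ->]]]; exact/ltW/h].
Qed.

Lemma cvg_mean_shift (v : nat -> R) : v @ \oo --> 0 ->
  (fun n : nat => n%:R^-1 * \sum_(k < n) v k.+1) @ \oo --> (0 : R).
Proof.
move=> v0; have /cesaro h : (fun k => v k.+1) @ \oo --> (0 : R) by rewrite (cvg_shiftS v).
rewrite -(cvg_shiftS (fun n : nat => n%:R^-1 * \sum_(k < n) v k.+1)).
apply: cvg_trans h; apply: near_eq_cvg; apply: nearW => n /=.
by rewrite /arithmetic_mean /series /= big_mkord.
Qed.

End oscillation.

Section entropy_growth.
Context {R : realType} {A : pmetricType R}.
Local Notation Omega := (seqspace A).
Local Notation sigma := (@Defs.shift R A).
Local Notation coord_space := (@coord_space R A).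
Hypothesis cA : compact [set: A].
Let cO : compact [set: Omega] := seqspace_compact cA.
Implicit Types (L : set nat) (mu : probability (borel Omega) R).

Lemma measurable_to_coord_spaceP dX (X : measurableType dX) L (F : X -> coord_space L) :
  (forall i, L i -> measurable_fun [set: X] (fun t => (F t : Omega) i : borel A)) ->
  measurable_fun [set: X] F.
Proof.
move=> mF; apply: (@measurability _ _ X (coord_space L) _ _ (@coord_sets R A L)) => //.
move=> _ [_ [i Li [B mB <-]] <-]; rewrite !setTI.
by have := mF i Li measurableT B mB; rewrite setTI.
Qed.

Lemma measurable_coord L i : L i ->
  measurable_fun [set: coord_space L] (fun x : coord_space L => (x : Omega) i : borel A).
Proof.
move=> Li _ B mB; rewrite setTI; apply: sub_sigma_algebra; exists i => //.
by exists B => //; rewrite setTI.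
Qed.

(** The sets that do not separate [x] from [y] form a sigma-algebra containing the generators. *)
Lemma coord_space_agree n (phi : Omega -> R) :
  measurable_fun [set: coord_space `I_n] (phi : coord_space `I_n -> R) ->
  forall x y, agree n x y -> phi x = phi y.
Proof.
move=> mphi x y xy.
pose S : set (set Omega) := [set B | B x <-> B y].
have : measurable (phi @^-1` [set phi x] : set (coord_space `I_n)).
  by have := mphi measurableT [set phi x] (measurable_set1 _); rewrite setTI.
suff : <<s @coord_sets R A `I_n >> `<=` S.
  by move=> sub mB; have [h _] := sub _ mB; exact/esym/h.
apply: smallest_sub.
  split.
  - by split.
  - by move=> B [BxBy ByBx]; split => -[_ nB]; split => // ?; apply: nB; auto.
  - by move=> F SF; split => -[k _ Fk]; exists k => //; apply/(SF k).
move=> _ [i /= ilt [B mB <-]]; split => -[_ /=]; rewrite /preimage /= ?(xy i ilt) => Bi.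
  by split => //=; rewrite -(xy i ilt).
by split => //=; rewrite (xy i ilt).
Qed.

Lemma measurable_coordS n m (phi : Omega -> R) : (n <= m)%N ->
  measurable_fun [set: coord_space `I_n] (phi : coord_space `I_n -> R) ->
  measurable_fun [set: coord_space `I_m] (phi : coord_space `I_m -> R).
Proof.
move=> nm mphi.
have mid : measurable_fun [set: coord_space `I_m] (id : coord_space `I_m -> coord_space `I_n).
  apply: measurable_to_coord_spaceP => i /= im; apply: measurable_coord => /=.
  exact: leq_trans im nm.
exact: (measurableT_comp mphi mid).
Qed.

Lemma measurable_coord_shift n m (psi : Omega -> R) :
  measurable_fun [set: coord_space `I_m] (psi : coord_space `I_m -> R) ->
  measurable_fun [set: coord_space `I_(n + m)]
    (fun x : coord_space `I_(n + m) => psi (iter n sigma x)).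
Proof.
move=> mpsi.
have mS : measurable_fun [set: coord_space `I_(n + m)]
    (iter n sigma : coord_space `I_(n + m) -> coord_space `I_m).
  apply: measurable_to_coord_spaceP => i /= im.
  rewrite (_ : (fun t => _) = fun t : coord_space `I_(n + m) => (t : Omega) (n + i)%N).
    by apply: measurable_coord => /=; rewrite ltn_add2l.
  by apply/funext => t; exact: iter_shiftE.
exact: (measurableT_comp mpsi mS).
Qed.

Lemma measurable_truncate n (u : Omega -> R) : continuous u ->
  measurable_fun [set: coord_space `I_n] (fun x : coord_space `I_n => u (truncate n x)).
Proof.
move=> cu; apply: (@measurableT_comp _ _ _ _ _ _ (u : borel Omega -> R)).
  exact: continuous_borelR.
apply: (measurable_to_seqspace cA) => i; rewrite /truncate.
case: (boolP (i < n)%N) => im; [exact: measurable_coord|exact: measurable_cst].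
Qed.

Lemma iter_shift_invariant_int mu n (u : Omega -> R) (M : R) : shift_invariant mu ->
  measurable_fun [set: borel Omega] (u : borel Omega -> R) -> (forall x, `|u x| <= M) ->
  \int[mu]_x u (iter n sigma x) = \int[mu]_x u x.
Proof.
move=> inv mu_ uM; elim: n => // n IH; rewrite -IH.
have mS : measurable_fun [set: borel Omega] (iter n sigma : borel Omega -> borel Omega).
  by apply: continuous_borel; exact: iter_shift_continuous.
rewrite -(shift_invariant_int_bounded (u := fun x => u (iter n sigma x)) inv _ (fun x => uM _))//.
  by apply: eq_Rintegral => x _; rewrite iterSr.
exact: (measurableT_comp mu_ mS).
Qed.

Variables (d : Omega -> Omega -> R) (dm : metrizes_product d).
Variable p : probability (borel A) R.
Variables (g : Omega -> R) (cg : continuous g).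
Variables (nu : probability (borel Omega) R) (nuG : Gstar p g nu).
Variables (mu : probability (borel Omega) R) (muinv : shift_invariant mu).

(** Nearly optimal test functions [phi] and [psi] for the two blocks combine into
    [phi + psi o shift^n - c]; by [quasi_bernoulli], subtracting [c] restores the normalization of
    the exponential integral. *)
Lemma relative_entropy_superadditive (v : nat -> R) n m (r s : R) :
  (forall k x y, agree k x y -> `|g x - g y| <= v k) ->
  (r%:E < relative_entropy `I_n mu nu)%E -> (s%:E < relative_entropy `I_m mu nu)%E ->
  ((r + s - \sum_(k < n) v k.+1)%:E <= relative_entropy `I_(n + m) mu nu)%E.
Proof.
move=> gv /relative_entropy_approx[phi [M [mphi phiM ephi rphi]]].
move=> /relative_entropy_approx[psi [N [mpsi psiN epsi spsi]]].
set c := \sum_(k < n) _.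
have mphi' := measurable_coord_space mphi; have mpsi' := measurable_coord_space mpsi.
have mpsiS := measurable_coord_shift (n := n) mpsi.
have mphiS := measurable_coordS (leq_addr m n) mphi.
have i1 : mu.-integrable setT (EFin \o (phi : borel Omega -> R)) := bounded_integrable mu mphi' phiM.
have mpsiS' := measurable_coord_space mpsiS.
have i2 : mu.-integrable setT (EFin \o (fun x : borel Omega => psi (iter n sigma x))).
  exact: (bounded_integrable mu mpsiS' (fun x => psiN _)).
have mchi : measurable_fun [set: coord_space `I_(n + m)]
    (fun x : coord_space `I_(n + m) => phi x + psi (iter n sigma x) - c).
  by apply: measurable_funB => //; exact: measurable_funD.
apply: (@le_trans _ _ (\int[mu]_x (phi x + psi (iter n sigma x) - c))%:E); last first.
  apply: (@relative_entropy_ge _ _ `I_(n + m) mu nu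
    (fun x : Omega => phi x + psi (iter n sigma x) - c) (M + N + `|c|) mchi).
    move=> x; rewrite (le_trans (ler_normB _ _))// lerD2r.
    by rewrite (le_trans (ler_normD _ _))// lerD.
  have cphi := coord_space_agree mphi.
  have := quasi_bernoulli cA dm cg nuG gv mphi' phiM cphi mpsi' psiN.
  rewrite -/c => qb.
  have -> : \int[nu]_x expR (phi x + psi (iter n sigma x) - c) =
      expR (- c) * \int[nu]_x expR (phi x + psi (iter n sigma x)).
    rewrite -RintegralZl//.
      by apply: eq_Rintegral => x _; rewrite expRD mulrC.
    apply: (@bounded_integrable _ _ _ _ _ (expR (M + N))).
      by apply: measurableT_comp => //; exact: measurable_funD.
    move=> x; rewrite ger0_norm ?expR_ge0// ler_expR (le_trans (ler_norm _))//.
    by rewrite (le_trans (ler_normD _ _))// lerD.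
  rewrite expRN mulrC ler_pdivrMr ?expR_gt0// mul1r; apply: (le_trans qb).
  rewrite -[leRHS]mulr1 ler_pM2l ?expR_gt0// mulr_ile1//.
    by apply: Rintegral_ge0 => x _; exact: expR_ge0.
  by apply: Rintegral_ge0 => x _; exact: expR_ge0.
have ic : mu.-integrable setT (EFin \o (fun _ : borel Omega => c)).
  by apply: (@bounded_integrable _ _ _ _ _ `|c|).
rewrite RintegralB//; last exact: (integrableD measurableT i1 i2).
rewrite RintegralD// (iter_shift_invariant_int n muinv mpsi' psiN) Rintegral_cst_prob.
by rewrite lee_fin lerD2r lerD// ltW.
Qed.

Definition birkhoff_sum (u : Omega -> R) n x := \sum_(k < n) u (iter k sigma x).

Lemma continuous_birkhoff_sum u n : continuous u -> continuous (birkhoff_sum u n).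
Proof.
move=> cu; elim: n => [|n IH].
  rewrite (_ : birkhoff_sum u 0 = fun=> 0); first by move=> x; exact: cst_continuous.
  by apply/funext => x; rewrite /birkhoff_sum big_ord0.
rewrite (_ : birkhoff_sum u n.+1 = fun x => birkhoff_sum u n x + u (iter n sigma x)).
  apply: continuous_add => // x.
  exact: continuous_comp (iter_shift_continuous (x := x)) (cu _).
by apply/funext => x; rewrite /birkhoff_sum big_ord_recr.
Qed.

Lemma birkhoff_sumS u n x : birkhoff_sum u n.+1 x = u x + birkhoff_sum u n (sigma x).
Proof.
rewrite /birkhoff_sum big_ord_recl; congr (_ + _).
by apply: eq_bigr => k _; rewrite -iterSr.
Qed.

(** A Birkhoff sum depends on all coordinates. Truncating its argument costs [c], and a second [c]
    is subtracted to keep the exponential integral at most 1; hence the factor 2. *)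
Lemma relative_entropy_lower (psi : Omega -> R) (v : nat -> R) n :
  continuous psi -> (forall k x y, agree k x y -> `|psi x - psi y| <= v k) ->
  \int[nu]_x expR (birkhoff_sum psi n x) <= 1 ->
  ((n%:R * \int[mu]_x psi x - 2 * \sum_(k < n) v k.+1)%:E <= relative_entropy `I_n mu nu)%E.
Proof.
move=> cpsi psiv eS.
set c := \sum_(k < n) _; pose S := birkhoff_sum psi n.
have cS : continuous S := @continuous_birkhoff_sum psi n cpsi.
have [M _ SM] := compact_bounded_fun cO cS.
have Str x : `|S x - S (truncate n x)| <= c.
  rewrite /S /birkhoff_sum -sumrB (le_trans (ler_norm_sum _ _ _))//.
  (* After [k] shifts, [x] and its truncation still agree on [n - k] coordinates, so the variations
     occur in reverse order. *)
  rewrite /c [leRHS](reindex_inj rev_ord_inj) /=; apply: ler_sum => k _.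
  have -> : (n - k.+1).+1 = (n - k)%N by rewrite subnSK.
  apply: psiv => i ink; rewrite !iter_shiftE /truncate.
  by rewrite ifT// -ltn_subRL.
pose phi x := S (truncate n x) - c.
have mphi : measurable_fun [set: coord_space `I_n] (phi : coord_space `I_n -> R).
  by apply: measurable_funB => //; exact: measurable_truncate.
have phiM x : `|phi x| <= M + `|c|.
  by rewrite (le_trans (ler_normB _ _))// lerD2r.
have mphi' := measurable_coord_space mphi.
have iS : mu.-integrable setT (EFin \o (S : borel Omega -> R)) := continuous_integrable mu cO cS.
apply: (@le_trans _ _ (\int[mu]_x phi x)%:E); last first.
  apply: (@relative_entropy_ge _ _ `I_n mu nu phi (M + `|c|) mphi phiM); apply: le_trans eS.
  apply: le_Rintegral => //.
  - apply: (@bounded_integrable _ _ _ _ _ (expR (M + `|c|))); first exact: measurableT_comp.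
    by move=> x; rewrite ger0_norm ?expR_ge0// ler_expR (le_trans (ler_norm _)).
  - exact: (continuous_integrable nu cO (continuous_expR_comp cS)).
  - move=> x _; rewrite ler_expR /phi -/(S x).
    by have /ler_normlP[] := Str x; lra.
rewrite lee_fin.
have -> : n%:R * \int[mu]_x psi x = \int[mu]_x S x.
  rewrite /S; elim: n {c cS Str phi mphi phiM mphi' iS SM eS S} => [|n IH].
    rewrite mul0r (_ : birkhoff_sum psi 0 = fun=> 0) ?Rintegral_cst_prob//.
    by apply/funext => x; rewrite /birkhoff_sum big_ord0.
  have cSn := @continuous_birkhoff_sum psi n cpsi.
  have -> : \int[mu]_x birkhoff_sum psi n.+1 x =
      \int[mu]_x (psi x + birkhoff_sum psi n (sigma x)).
    by apply: eq_Rintegral => x _; rewrite birkhoff_sumS.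
  rewrite continuous_intD//; last exact: continuous_shift_comp.
  by rewrite (shift_invariant_int cA muinv cSn) -IH -natr1 mulrDl mul1r addrC.
have cc : continuous (fun _ : Omega => 2 * c) by move=> x; exact: cst_continuous.
rewrite -[2 * c](Rintegral_cst_prob mu) -continuous_intB//.
apply: le_Rintegral => //.
- exact: (continuous_integrable mu cO (continuous_sub cS cc)).
- exact: (bounded_integrable mu mphi' phiM).
- move=> x _; rewrite /phi; have /ler_normlP[_] := Str x.
  have arith (a b r : R) : a - b <= r -> a - 2 * r <= b - r by lra.
  exact: arith.
Qed.

(** The operator sends [exp psi * (F o shift)] to [F], so invariance of [nu] under the transpose
    removes one term of the sum at a time. *)
Lemma exp_birkhoff_sum (psi : Omega -> R) n : continuous psi ->
  (forall x, ruelle p g (fun y => expR (psi y)) x = 1) ->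
  \int[nu]_x expR (birkhoff_sum psi n x) = 1.
Proof.
move=> cpsi L1; have ce := continuous_expR_comp cpsi.
elim: n => [|n IH].
  rewrite -[RHS](Rintegral_cst_prob nu); apply: eq_Rintegral => x _.
  by rewrite /birkhoff_sum big_ord0 expR0.
have cS := continuous_expR_comp (@continuous_birkhoff_sum psi n cpsi).
have -> : \int[nu]_x expR (birkhoff_sum psi n.+1 x) =
    \int[nu]_x (expR (psi x) * expR (birkhoff_sum psi n (sigma x))).
  by apply: eq_Rintegral => x _; rewrite birkhoff_sumS expRD.
rewrite -nuG; last by apply: continuous_mul => //; exact: (continuous_shift_comp cS).
rewrite -[RHS]IH; apply: eq_Rintegral => x _.
by rewrite (@ruelle_shift _ _ cA p g _ (fun y => expR (birkhoff_sum psi n y)))// L1 mul1r.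
Qed.

End entropy_growth.

(** * Fekete's lemma for extended-real sequences, superadditive up to [o(n)] *)

Section fekete.
Context {R : realType}.
Variables (a : nat -> \bar R) (c : nat -> R).
Hypothesis a0 : forall n, (0 <= a n)%E.
Hypothesis asup : forall n m (r s : R), (r%:E < a n)%E -> (s%:E < a m)%E ->
  ((r + s - c n)%:E <= a (n + m)%N)%E.
Hypothesis c0 : (fun n : nat => n%:R^-1 * c n) @ \oo --> (0 : R).
Let b n : \bar R := ((n%:R^-1)%:E * a n)%E.

Let lt_mean n (r : R) : (0 < n)%N -> (r%:E < b n)%E = ((n%:R * r)%:E < a n)%E.
Proof. by move=> n0; rewrite /b lte_pdivlMl ?ltr0n// EFinM. Qed.

(** Cut off [k] blocks of length [n]. Of the rest only [a m >= 0] is known, and -1 serves as a real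
    strictly below it. *)
Let asup_iter n (r1 r0 : R) : (r1%:E < a n)%E -> r0 < r1 ->
  forall k m, ((k%:R * (r0 - c n) - 1)%:E < a (k * n + m)%N)%E.
Proof.
move=> r1a r01; elim=> [|k IH] m.
  by rewrite mul0r sub0r mul0n add0n (lt_le_trans _ (a0 m))// lte_fin ltrN10.
rewrite mulSn -addnA; apply: lt_le_trans (asup r1a (IH m)).
by rewrite lte_fin -natr1 mulrDl mul1r; lra.
Qed.

(** Fix one good [n] and divide [N] by it. Of the margin [3 e], one [e] provides the strict
    inequality in [asup_iter], one absorbs [c n <= n e], and one pays for the remainder of the
    division and the -1 once [N >= K]. *)
Let eventually_ge (r e : R) : 0 <= r -> 0 < e ->
  (forall N, exists2 n, (N <= n)%N & ((r + 3 * e)%:E < b n)%E) ->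
  \forall N \near \oo, (r%:E <= b N)%E.
Proof.
move=> r0 e0 freq.
have /cvgrPdist_le/(_ _ e0)[N0 _ cN0] := c0.
have [n nN ren] := freq (maxn N0 1).
have n0 : (0 < n)%N by apply: leq_trans nN; rewrite leq_maxr.
have nR : (0 : R) < n%:R by rewrite ltr0n.
have cn : c n <= n%:R * e.
  have /= := cN0 n (leq_trans (leq_maxl _ _) nN).
  rewrite sub0r normrN => /(le_trans (ler_norm _)).
  by rewrite mulrC ler_pdivrMr// mulrC.
rewrite lt_mean// in ren.
have r01 : n%:R * (r + 2 * e) < n%:R * (r + 3 * e) by rewrite ltr_pM2l//; lra.
have it := asup_iter ren r01.
pose K := (n%:R * (r + e) + 1) / e.
exists (maxn 1 (Num.truncn K).+1) => // N /=; rewrite geq_max => /andP[N1 NK].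
have NR : (0 : R) < N%:R by rewrite ltr0n.
have KN : K <= N%:R by apply/ltW/(lt_le_trans (truncnS_gt _)); rewrite ler_nat.
rewrite /b lee_pdivlMl// -EFinM.
have := it (N %/ n)%N (N %% n)%N; rewrite -divn_eq => /ltW; apply: le_trans.
rewrite lee_fin.
have h1 : N%:R < (N %/ n)%:R * n%:R + n%:R :> R.
  by rewrite -natrM -natrD ltr_nat [X in (X < _)%N](divn_eq N n) ltn_add2l ltn_mod.
have h2 : n%:R * (r + e) <= n%:R * (r + 2 * e) - c n.
  by rewrite -subr_ge0; rewrite (_ : _ - _ = n%:R * e - c n) ?subr_ge0//; ring.
have h3 : (N %/ n)%:R * (n%:R * (r + e)) <= (N %/ n)%:R * (n%:R * (r + 2 * e) - c n).
  by rewrite ler_wpM2l.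
have h4 : (N%:R - n%:R) * (r + e) <= (N %/ n)%:R * n%:R * (r + e).
  by rewrite ler_wpM2r//; lra.
have h5 : n%:R * (r + e) + 1 <= N%:R * e by rewrite -ler_pdivrMr.
rewrite -mulrA in h4; have h6 := le_trans h4 h3.
rewrite lerBrDr; apply: le_trans h6.
have -> : (N%:R - n%:R) * (r + e) = N%:R * r + (N%:R * e - n%:R * (r + e)) by ring.
by rewrite lerD2l lerBrDr addrC.
Qed.

(** A gap between the lower limit [i] and the upper limit [s] would leave room for [r] and [r + 3 e]
    strictly between them, against [eventually_ge]. *)
Lemma fekete : cvgn b.
Proof.
have b0 n : (0 <= b n)%E by rewrite mule_ge0// lee_fin invr_ge0.
pose s := ereal_inf (range (esups b)); pose i := ereal_sup (range (einfs b)).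
have be n : (einfs b n <= b n <= esups b n)%E.
  by apply/andP; split; [apply: ereal_inf_lbound|apply: ereal_sup_ubound]; exists n => /=.
have i0 : (0 <= i)%E.
  apply: (@le_trans _ _ (einfs b 0%N)); last by apply: ereal_sup_ubound; exists 0%N.
  by apply/ereal_infP => _ [n _ <-]; exact: b0.
have si : (s <= i)%E.
  rewrite leNgt; apply/negP => lis.
  have [r [e [r0 e0 ir res]]] : exists r e,
      [/\ 0 <= r, 0 < e, (i < r%:E)%E & ((r + 3 * e)%:E < s)%E].
    move: i0 lis; case: i => [i| |]//; last by case: s.
    rewrite lee_fin => i0; case: s => [t|_|]//.
      (* Fifths of the gap: [r] is the first division point and [r + 3 e] the fourth. *)
      rewrite lte_fin => it; exists (i + (t - i) / 5), ((t - i) / 5).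
      have h : 0 < (t - i) / 5 by rewrite divr_gt0// subr_gt0.
      by split; rewrite ?lte_fin; lra.
    exists (i + 1), 1; split; rewrite ?lte_fin ?ltry//; lra.
  have [N _ Nr] : \forall N \near \oo, (r%:E <= b N)%E.
    apply: (eventually_ge r0 e0) => N.
    have /ereal_sup_gt[_ [n /= Nn <-] h] : ((r + 3 * e)%:E < esups b N)%E.
      by apply: lt_le_trans res _; apply: ereal_inf_lbound; exists N.
    by exists n.
  suff : (r%:E <= i)%E by rewrite leNgt ir.
  apply: (@le_trans _ _ (einfs b N)); last by apply: ereal_sup_ubound; exists N.
  by apply/ereal_infP => _ [n /= Nn <-]; exact: Nr.
have is_ : (i <= s)%E.
  apply/ereal_infP => _ [n _ <-]; apply/ereal_supP => _ [m _ <-].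
  apply: (@le_trans _ _ (b (maxn m n))).
    by apply: ereal_inf_lbound; exists (maxn m n) => //=; exact: leq_maxl.
  by apply: ereal_sup_ubound; exists (maxn m n) => //=; exact: leq_maxr.
have E : s = i by apply/le_anti; rewrite si is_.
apply/cvg_ex; exists s; apply: (squeeze_cvge (nearW _ be)).
  by rewrite E; exact: cvg_einfs_sup.
exact: cvg_esups_inf.
Qed.

End fekete.

(** * Vanishing specific entropy *)

Section specific_entropy_zero.
Context {R : realType} {A : pmetricType R}.
Local Notation Omega := (seqspace A).
Hypothesis cA : compact [set: A].
Variables (d : Omega -> Omega -> R) (dm : metrizes_product d).
Variable p : probability (borel A) R.
Variables (g : Omega -> R) (cg : continuous g).
Hypothesis g1 : forall x, ruelle p g (cst 1) x = 1.
Variables (nu : probability (borel Omega) R) (nuG : Gstar p g nu).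
Variables (mu : probability (borel Omega) R) (muinv : shift_invariant mu).

(* Convergence matters: [limn] of a divergent sequence is the junk value 0. *)
Lemma cvg_specific_entropy :
  cvgn (fun n : nat => ((n%:R^-1)%:E * relative_entropy `I_n mu nu)%E).
Proof.
have [v [v0 gv vcvg]] := oscillation cA cg.
apply: (@fekete _ _ (fun n => \sum_(k < n) v k.+1)).
- by move=> n; exact: relative_entropy_ge0.
- by move=> n m r s; exact: (relative_entropy_superadditive cA dm cg nuG muinv).
- exact: cvg_mean_shift.
Qed.

(* If [mu] is not in [Gstar], then some [psi] with [L_g (exp psi) = 1] has a
   positive [mu]-integral, and its Birkhoff sums bound the entropy from below. *)
Lemma specific_entropy_eq0 : specific_entropy mu nu = 0%E -> Gstar p g mu.
Proof.
move=> h0; apply: (Gstar_of_le cA cg g1) => phi cphi; rewrite leNgt; apply/negP => lt.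
pose L := ruelle p g (fun y => expR (phi y)).
have ce := continuous_expR_comp cphi.
have cL : continuous L by exact: ruelle_continuous.
have L0 x : 0 < L x by apply: ruelle_gt0 => // y; exact: expR_gt0.
have cl := continuous_ln_comp cL L0.
have cls := continuous_shift_comp cl.
pose psi x := phi x - ln (L (Defs.shift x)).
have cpsi : continuous psi by exact: continuous_sub.
have psi1 x : ruelle p g (fun y => expR (psi y)) x = 1.
  have -> : ruelle p g (fun y => expR (psi y)) x =
      ruelle p g (fun y => expR (phi y) * (L (Defs.shift y))^-1) x.
    by apply: eq_Rintegral => a _; rewrite /psi expRD expRN lnK ?posrE.
  rewrite (@ruelle_shift _ _ cA p g (fun y => expR (phi y)) (fun y => (L y)^-1))//.
  by rewrite mulfV// gt_eqF.
have eta0 : 0 < \int[mu]_x psi x.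
  by rewrite continuous_intB// (shift_invariant_int cA muinv cl) subr_gt0.
have [v [v0 psiv vcvg]] := oscillation cA cpsi.
set eta := \int[mu]_x psi x in eta0.
(* The lower bound loses twice the sum of the variations, which is at most [n * eta / 2]; a specific
   entropy of at least [eta / 2] remains. *)
have eta8 : 0 < eta / 4 by rewrite divr_gt0.
have /cvgrPdist_le/(_ _ eta8)[N _ hN] := cvg_mean_shift vcvg.
have : ((eta / 2)%:E <= specific_entropy mu nu)%E.
  apply: lime_ge; first exact: cvg_specific_entropy.
  exists (maxn 1 N) => // n /=; rewrite geq_max => /andP[n0 Nn].
  have nR : (0 : R) < n%:R by rewrite ltr0n.
  rewrite lee_pdivlMl// -EFinM.
  apply: le_trans (relative_entropy_lower cA muinv cpsi psiv _); last first.
    by rewrite (exp_birkhoff_sum cA cg nuG).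
  rewrite lee_fin -/eta; have /= := hN n Nn; set c := \sum_(k < n) _.
  rewrite sub0r normrN => /(le_trans (ler_norm _)).
  rewrite mulrC ler_pdivrMr// [_ * n%:R]mulrC.
  have arith (x y z : R) : y <= x * (z / 4) -> x * (z / 2) <= x * z - 2 * y by lra.
  exact: arith.
by rewrite h0 lee_fin leNgt divr_gt0.
Qed.

End specific_entropy_zero.

Theorem theorem4 (R : realType) (A : pmetricType R)
  (A_compact : compact [set: A])
  (d : seqspace A -> seqspace A -> R) (d_metric : metrizes_product d)
  (alpha : R) (alpha_gt0 : 0 < alpha) (alpha_lt1 : alpha < 1)
  (p : probability (borel A) R) (p_full : full_support p)
  (RPF : forall g, holder d alpha g -> exists h, RPF_eigenfunction d alpha p g h)
  (f : seqspace A -> R) (f_holder : holder d alpha f)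
  (h_f : seqspace A -> R) (h_f_RPF : RPF_eigenfunction d alpha p f h_f)
  (mu_f : probability (borel (seqspace A)) R)
  (mu_f_unique : is_the_measure mu_f (Gstar p (normalized d alpha p f h_f)))
  (mu_f_invariant : shift_invariant mu_f) :
  (forall mu : probability (borel (seqspace A)) R, shift_invariant mu ->
     (specific_entropy mu mu_f = 0%E <->
      Gstar p (normalized d alpha p f h_f) mu)) /\
  (exists mu : probability (borel (seqspace A)) R,
     is_the_measure mu (equilibrium_state d alpha p f)).
Proof.
have mu_fG : Gstar p (normalized d alpha p f h_f) mu_f by apply/mu_f_unique.
have cf : continuous f := holder_continuous d_metric alpha_gt0 f_holder.
have cfbar := normalized_continuous d_metric alpha_gt0 cf h_f_RPF.
split.
  move=> mu mu_inv; split.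
    apply: (specific_entropy_eq0 A_compact d_metric cfbar) => // x.
    exact: (ruelle_normalized1 A_compact d_metric alpha_gt0 x cf h_f_RPF).
  move=> /mu_f_unique mu_eq; rewrite /specific_entropy.
  rewrite (_ : (fun n => _) = fun=> 0%E) ?lim_cst//.
  by apply/funext => n; rewrite relative_entropy_eq ?mule0.
exists mu_f => mu; split => [eq_mu|mu_eq].
  apply/mu_f_unique.
  exact: (equilibrium_Gstar A_compact d_metric alpha_gt0 alpha_lt1 RPF f_holder
            h_f_RPF mu_f_invariant mu_fG eq_mu).
(* [mu] and [mu_f] are equal on measurable sets only, so invariance is transported through the
   measurable preimage. *)
have mu_inv : shift_invariant mu.
  move=> B mB.
  have mshift : measurable_fun [set: borel (seqspace A)]
      (@Defs.shift R A : borel (seqspace A) -> borel (seqspace A)).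
    by apply: continuous_borel; exact: shift_continuous.
  have mSB : measurable (@Defs.shift R A @^-1` B : set (borel (seqspace A))).
    by rewrite -[X in measurable X]setTI; exact: mshift.
  exact: etrans (mu_eq _ mSB) (etrans (mu_f_invariant _ mB) (esym (mu_eq _ mB))).
apply: (Gstar_equilibrium A_compact d_metric alpha_gt0 RPF f_holder h_f_RPF) => //.
exact/mu_f_unique.
Qed.
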